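(* Assume the periodicity assumption and assumption (H) of the context, with its constant $\theta_0$, functions $V,\eta$ and probability measure $\nu$, and set $\eta_k:=\theta_0^{-k}P_k\eta$ for $k\in\mathbb Z_+$. Then for all bounded measurable $f:E\to\mathbb R$ and all probability measures $\mu$ on $E$ such that $\mu|_{A_i}(\eta_{t-i})>0$ for some $i\in\{0,\dots,t-1\}$ and $\mu|_{A_i}P_{t-i}V<+\infty$ for all $i\in\{0,\dots,t-1\}$, $$\lim_{N\to+\infty}\mathbb P_\mu\left(\left|\frac1{N+1}\sum_{m=0}^Nf(X_m)-\frac{\theta_0^{-t}}{t}\sum_{\ell=0}^{t-1}\nu P_\ell(fP_{t-\ell}\eta)\right|>\varepsilon\ \Big|\ N<\tau_\partial\right)=0,\qquad\forall\varepsilon>0.$$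
   Context: Let $E$ be a measurable space, $\partial\notin E$, and let $(X_n)_{n\in\mathbb Z_+}$ be a Markov chain on $E\cup\{\partial\}$ for which $\partial$ is absorbing; $\mathbb P_x$ (resp. $\mathbb P_\mu$) is its law started from $x$ (resp. from the distribution $\mu$), with expectation $\mathbb E_x$ (resp. $\mathbb E_\mu$), and $\tau_\partial=\inf\{n\ge 0: X_n=\partial\}$. Its sub-Markov semigroup on $E$ is $P_nf(x)=\mathbb E_x(f(X_n)\mathbf 1_{n<\tau_\partial})$, $x\in E$, for measurable $f$ on $E$ that is nonnegative or satisfies $P_n|f|(x)<\infty$; for a positive measure $\mu$ on $E$, $\mu P_nf=\int_E P_nf\,d\mu$. $\mu|_{A}$ denotes the restriction $\mu(\cdot\cap A)$. Periodicity assumption: for a positive integer $t$, $E$ is the disjoint union of measurable sets $A_0,\dots,A_{t-1}$ such that for all $x\in A_i$, $P_1\mathbf 1_{A_j}(x)=0$ if $j\ne i+1$ and $P_1\mathbf 1_{A_j}(x)=P_1\mathbf 1_E(x)$ if $j=i+1$, with the convention $i+1=0$ if $i=t-1$. $Q_k:=P_{kt}$, $k\ge0$, acts on functions on $A_0$. Functions on $A_0$ (in particular $V$ and $\eta$) and measures on $A_0$ are extended by $0$ to $E\setminus A_0$. Assumption (H): there exist a measurable $V:A_0\to[1,+\infty)$, constants $\theta_0\in(0,1]$, $C_Q\in\mathbb R_+$, $\alpha\in(0,1)$, a nonzero measurable $\eta:A_0\to\mathbb R_+$ with $\eta/V$ bounded, and a probability measure $\nu$ on $A_0$ with $\nu(V)<+\infty$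 and $\nu(\eta)>0$, such that $$\left|\theta_0^{-kt}Q_kf(x)-\eta(x)\nu(f)\right|\le C_Q\,\alpha^k\,V(x)$$ for all measurable $f$ on $A_0$ with $|f|\le V$, all $k\ge0$ and all $x\in A_0$. *)

(* Defs.v *)
From HB Require Import structures.
From mathcomp Require Import all_boot all_order all_algebra.
From mathcomp Require Import all_classical all_reals all_analysis.

Set Implicit Arguments.
Unset Strict Implicit.
Unset Printing Implicit Defensive.

Import Order.TTheory GRing.Theory Num.Theory.
Import numFieldNormedType.Exports.

Local Open Scope classical_set_scope.
Local Open Scope ring_scope.

(* E together with a cemetery point is [option E], with [None] the cemetery;
   [None] is a measurable singleton and the trace sigma-algebra on E is the
   original one. *)
Section option_measurable.
Context d (E : measurableType d).

Definition option_measurable : set (set (option E)) :=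
  [set B | measurable (Some @^-1` B)].

Lemma option_measurable0 : option_measurable set0.
Proof. by rewrite /option_measurable /= preimage_set0. Qed.

Lemma option_measurableC B : option_measurable B -> option_measurable (~` B).
Proof. by rewrite /option_measurable /= preimage_setC; exact: measurableC. Qed.

Lemma option_measurable_bigcup (F : (set (option E))^nat) :
  (forall i, option_measurable (F i)) -> option_measurable (\bigcup_i F i).
Proof.
by move=> mF; rewrite /option_measurable /= preimage_bigcup;
  exact: bigcupT_measurable.
Qed.

HB.instance Definition _ := @isMeasurable.Build d (option E) option_measurable
  option_measurable0 option_measurableC option_measurable_bigcup.

End option_measurable.

Section absorbed_chain.
Context d d' (R : realType) (E : measurableType d) (Om : measurableType d').
Variables (P : R.-pker (option E) ~> Om) (X : nat -> Om -> option E).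

(* sigma(X_0, ..., X_n) *)
Definition past (n : nat) : set (set Om) :=
  <<s \bigcup_(k in [set k | (k <= n)%N])
        preimage_set_system setT (X k) measurable >>.

(* [P x] is the law started from x; the transition kernel of the chain is
   (x, B) |-> P x {X_1 \in B}. *)
Record absorbed_markov_chain : Prop := {
  chain_measurable : forall n, measurable_fun setT (X n) ;
  chain_start : forall x B, measurable B -> P x (X 0%N @^-1` B) = \d_x B ;
  chain_markov : forall x n F B, past n F -> measurable B ->
    P x (F `&` X n.+1 @^-1` B) =
    (\int[P x]_(w in F) P (X n w) (X 1%N @^-1` B))%E ;
  chain_absorbing : P None [set w | X 1%N w = None] = 1%E }.

Local Open Scope ereal_scope.

Definition tau (w : Om) : \bar R :=
  ereal_inf [set k%:R%:E | k in [set k : nat | X k w = None]].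

Definition alive (n : nat) : set Om := [set w | n%:R%:E < tau w].

(* Extended-real functions are allowed because P_n f may take the value +oo
   for f >= 0. The default value 0 at [None] is irrelevant on [alive n]. *)
Definition Psg (n : nat) (f : E -> \bar R) (x : E) : \bar R :=
  \int[P (Some x)]_(w in alive n) oapp f 0 (X n w).

Definition Pinit (mu : probability E R) (B : set Om) : \bar R :=
  \int[mu]_x P (Some x) B.

Definition Pcond (mu : probability E R) (B C : set Om) : R :=
  (fine (Pinit mu (B `&` C)) / fine (Pinit mu C))%R.

(* Only A 0, ..., A (t - 1) are relevant. *)
Definition periodicity_assumption (t : nat) (A : nat -> set E) : Prop :=
  [/\ (0 < t)%N,
      forall i, (i < t)%N -> measurable (A i),
      trivIset [set i | (i < t)%N] A,
      \bigcup_(i in [set i | (i < t)%N]) A i = setT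
    & forall i j x, (i < t)%N -> (j < t)%N -> A i x ->
        Psg 1 (EFin \o \1_(A j)) x =
        if j == (i.+1 %% t)%N then Psg 1 (cst 1) x else 0].

(* A function on A0 is a function on E that vanishes off A0, and a measure on
   A0 is a measure on E carried by A0. *)
Record assumptionH (t : nat) (A0 : set E) (V eta : E -> R)
    (nu : probability E R) (theta0 C alpha : R) : Prop := {
  H_V_measurable : measurable_fun A0 V ;
  H_V_ge1 : forall x, A0 x -> (1 <= V x)%R ;
  H_V_ext : forall x, ~ A0 x -> V x = 0%R ;
  H_eta_measurable : measurable_fun A0 eta ;
  H_eta_ge0 : forall x, A0 x -> (0 <= eta x)%R ;
  H_eta_ext : forall x, ~ A0 x -> eta x = 0%R ;
  H_eta_neq0 : exists2 x, A0 x & eta x <> 0%R ;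
  H_eta_V : [bounded (eta x / V x)%R | x in A0] ;
  H_theta0 : (0 < theta0 <= 1)%R ;
  H_C : (0 <= C)%R ;
  H_alpha : (0 < alpha < 1)%R ;
  H_nu_A0 : nu A0 = 1 ;
  H_nu_V : \int[nu]_x (V x)%:E < +oo ;
  H_nu_eta : 0 < \int[nu]_x (eta x)%:E ;
  H_cvg : forall f : E -> R, measurable_fun A0 f ->
    (forall x, ~ A0 x -> f x = 0%R) ->
    (forall x, A0 x -> (`|f x| <= V x)%R) ->
    forall k x, A0 x ->
      `| (theta0 ^- (k * t))%:E * Psg (k * t) (EFin \o f) x
         - (eta x)%:E * \int[nu]_y (f y)%:E | <= (C * alpha ^+ k * V x)%:E }.

Definition eta_ (theta0 : R) (eta : E -> R) (k : nat) (x : E) : \bar R :=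
  (theta0 ^- k)%:E * Psg k (EFin \o eta) x.

(* The summand of index l is nu P_l (f P_(t-l) eta). *)
Definition ergodic_limit (t : nat) (theta0 : R) (eta : E -> R)
    (nu : probability E R) (f : E -> R) : \bar R :=
  (theta0 ^- t / t%:R)%:E *
  \sum_(l < t)
    \int[nu]_x Psg l (fun y => (f y)%:E * Psg (t - l) (EFin \o eta) y) x.

Definition time_average (f : E -> R) (N : nat) (w : Om) : R :=
  (N.+1%:R^-1 * \sum_(m < N.+1) oapp f 0 (X m w))%R.

End absorbed_chain.

(* Main.v *)
Require Import Defs.
From HB Require Import structures.
From mathcomp Require Import all_boot all_order all_algebra.
From mathcomp Require Import all_classical all_reals all_analysis.
From mathcomp Require Import measurable_realfun ring lra zify.
Import Order.TTheory GRing.Theory Num.Theory.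
Import numFieldNormedType.Exports.

Set Implicit Arguments.
Unset Strict Implicit.
Unset Printing Implicit Defensive.

Local Open Scope classical_set_scope.
Local Open Scope ring_scope.

(* For nonnegative bounded f the theorem follows from Chebyshev's inequality.
   On A_0, put T^k = theta0^(-kt) Q_k, let S_n = f(X_0) + ... + f(X_(n-1)) and
   F h(x) = theta0^(-t) E_x[S_t h(X_t); t < tau]. By (H), T^k h is close to
   eta nu(h) with an error alpha^k V. The Markov property writes the killed
   moments E_x[S_n^p h(X_n); n < tau], p = 1, 2, over n = K t steps as sums of
   T^k F T^j h and T^k F T^i F T^j h, and each factor F contributes, up to a
   geometrically small error, lam = nu(F eta). Hence
   theta0^(-Kt) E_x[(S_(Kt) - K lam)^2; K t < tau] = O(K V(x)), while
   P_mu(N < tau) is at least of order theta0^N. Since lam / t is the announced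
   limit, the conditional probability is O(1/N). A chain started in A_i enters
   A_0 after t - i steps.

   Only functions with values in [0, +oo] are integrated in these estimates:
   P_l V and P_l eta may be +oo outside A_0. This is why second moments are
   centred only at the end and why a signed f is split into its positive and
   negative parts. *)

(** Only one-sided estimates enter: upper bounds for T^K 1 and for the second moment, and a lower
    bound for the first. Each has the form (multiple of eta) plus or minus (error) V. In E[S^2] + (K
    lam)^2 P - 2 K lam E[S] the multiples of eta are K^2 lam^2 (1 + 1 - 2) = 0, so the order K^2
    disappears and the errors decide. They stay O(K) because peeling off a block raises the
    exponents in alpha^i and alpha^j by one. With s = 1/(1 - alpha), the identity s alpha^i =
    alpha^i + s alpha^(i+1) lets an induction on K absorb such errors. The Markov property is given
    for events only. Weights such as S_n^2 are reached by monotone approximation, which also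
    tolerates the value +oo. *)

(** * Induction over nonnegative measurable functions *)

Section ge0_measurable_ind.
Context d (T : measurableType d) (R : realType).
Local Open Scope ereal_scope.
Import HBNNSimple.
Variable Q : (T -> \bar R) -> Prop.
Hypothesis Q1 : forall A, measurable A -> Q (fun x => (\1_A x)%:E).
Hypothesis QZ : forall (k : R) (g : T -> \bar R),
  (0 <= k)%R -> measurable_fun setT g ->
  (forall x, 0 <= g x) -> Q g -> Q (fun x => k%:E * g x).
Hypothesis QD : forall g h : T -> \bar R,
  measurable_fun setT g -> (forall x, 0 <= g x) ->
  measurable_fun setT h -> (forall x, 0 <= h x) ->
  Q g -> Q h -> Q (fun x => g x + h x).
Hypothesis Qlim : forall g : nat -> T -> \bar R,
  (forall n, measurable_fun setT (g n)) -> (forall n x, 0 <= g n x) ->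
  (forall x, nondecreasing_seq (g ^~ x)) -> (forall n, Q (g n)) ->
  Q (fun x => limn (g ^~ x)).

(** Every such function is the increasing limit of its dyadic approximations, which are finite sums
    of scaled indicators. *)
Lemma ge0_measurable_ind (f : T -> \bar R) :
  measurable_fun setT f -> (forall x, 0 <= f x) -> Q f.
Proof.
move=> mf f0.
pose g n x := (nnsfun_approx measurableT mf n x)%:E.
have -> : f = fun x => limn (g ^~ x).
  apply/funext => x; apply/esym/cvg_lim => //.
  by apply: cvg_nnsfun_approx.
have QS (A : set T) (k : R) : measurable A -> (0 <= k)%R ->
    Q (fun x => (k * \1_A x)%:E).
  move=> mA k0; under eq_fun do rewrite EFinM.
  apply: QZ => //; try exact: Q1.
  by apply/measurable_EFinP; exact: measurable_indic.
have mS (A : set T) (k : R) : measurable A ->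
    measurable_fun setT (fun x => (k * \1_A x)%:E).
  move=> mA; under eq_fun do rewrite EFinM.
  by apply: measurable_funeM; apply/measurable_EFinP; exact: measurable_indic.
apply: (Qlim (g := g)).
- by move=> n; exact/measurable_EFinP.
- by move=> n x; rewrite lee_fin.
- by move=> x m n mn; rewrite lee_fin; exact/lefP/nd_nnsfun_approx.
- move=> n; rewrite /g nnsfun_approxE /approx.
  have mA k : measurable (dyadic_approx setT f n k).
    rewrite /dyadic_approx; case: ifPn => [kn|_]//; rewrite -preimage_comp.
    move: (mf) => mf'; apply: mf' => //; apply/measurable_image_EFin.
    exact: measurable_itv.
  have mB : measurable (integer_approx setT f n).
    by apply: emeasurable_fun_c_infty.
  under eq_fun do rewrite EFinD.
  pose D k : set T := dyadic_approx setT f n k.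
  pose S m (x : T) : \bar R := (\sum_(k < m) k%:R * 2 ^- n * \1_(D k) x)%:E.
  (* [QD] asks for measurability and sign of both summands, so these are carried along with [Q] in
     the induction on the number of dyadic levels. *)
  suff [mI [I0 QI]] : measurable_fun setT (S (n * 2 ^ n)%N) /\
      (forall x, 0 <= S (n * 2 ^ n)%N x) /\ Q (S (n * 2 ^ n)%N).
    apply: (QD (g := S (n * 2 ^ n)%N)) => //; [exact: mS|exact: QS].
  rewrite /S; elim: (n * 2 ^ n)%N => [|m [mI [I0 QI]]].
    under eq_fun do rewrite big_ord0.
    split=> //; split; first by move=> x; rewrite big_ord0.
    (* The zero function arises as a multiple of the indicator of the empty set. *)
    have := QS set0 0%R measurable0 (lexx _).
    by under eq_fun do rewrite mul0r.
  under eq_fun do rewrite big_ord_recr/= EFinD.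
  split; first by apply: emeasurable_funD => //; exact: mS.
  split.
    by move=> x; rewrite big_ord_recr/= lee_fin addr_ge0//; exact: I0.
  apply: QD => //; [exact: mS|exact: QS].
Qed.

End ge0_measurable_ind.

Section measurable_option.
Context d d2 (E : measurableType d) (U : measurableType d2).

Lemma measurable_fun_Some : measurable_fun setT (Some : E -> option E).
Proof. by move=> _ B mB; rewrite setTI. Qed.

Lemma measurable_set1_None : measurable [set (None : option E)].
Proof.
rewrite /measurable/= /option_measurable/= (_ : _ @^-1` _ = set0)//.
by apply/seteqP; split.
Qed.

Lemma measurable_fun_oapp (h : E -> U) (u : U) :
  measurable_fun setT h -> measurable_fun setT (oapp h u).
Proof.
move=> mh _ B mB; rewrite setTI /measurable/= /option_measurable/=.
by have := mh measurableT B mB; rewrite setTI.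
Qed.

End measurable_option.

(** * Past sigma-algebras, survival events and the one-step Markov property *)

Section chain.
Context d d' (R : realType) (E : measurableType d) (Om : measurableType d').
Variables (P : R.-pker (option E) ~> Om) (X : nat -> Om -> option E).
Hypothesis mc : absorbed_markov_chain P X.

(** [Om] with the sigma-algebra of the past of time [n]: a measurable function on this type is one
    that is known at time [n]. *)
Local Notation pastType n := (g_sigma_algebraType
  (\bigcup_(k in [set k | (k <= n)%N])
        preimage_set_system setT (X k) (@measurable _ (option E)))).

Lemma past_sub_measurable n F : past X n F -> measurable F.
Proof.
apply: smallest_sub; first exact: sigma_algebra_measurable.
move=> _ [k _] [B mB <-]; exact: (chain_measurable mc).
Qed.

Lemma measurable_fun_past d2 (U : measurableType d2) n (f : Om -> U) :
  measurable_fun setT (f : pastType n -> U) -> measurable_fun setT f.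
Proof.
move=> mf _ B mB; apply: (@past_sub_measurable n).
exact: (mf measurableT B mB).
Qed.

Lemma measurable_chain_past n k : (k <= n)%N ->
  measurable_fun setT (X k : pastType n -> option E).
Proof.
move=> kn _ B mB; apply: sub_sigma_algebra; exists k => //.
by exists B.
Qed.

Lemma past_le m n F : (m <= n)%N -> past X m F -> past X n F.
Proof.
move=> mn; apply: sub_smallest2r; first exact: smallest_sigma_algebra.
by move=> A [k /= km ?]; exists k => //=; exact: leq_trans km mn.
Qed.

Lemma aliveE n : alive R X n = [set w | forall k, (k <= n)%N -> X k w <> None].
Proof.
apply/seteqP; split => w; rewrite /alive /tau /=.
  move=> nt k kn XkN; move: nt; rewrite ltNge => /negP; apply.
  apply: (@le_trans _ _ k%:R%:E); last by rewrite lee_fin ler_nat.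
  by apply: ereal_inf_lbound; exists k.
(* Hitting times are integers, so the infimum is at least [n.+1], also when it is +oo. *)
move=> nN; apply: (@lt_le_trans _ _ n.+1%:R%:E).
  by rewrite lte_fin ltr_nat.
apply: le_ereal_inf_tmp => _ [k /= XkN <-]; rewrite lee_fin ler_nat ltnNge.
by apply/negP => kn; exact: nN XkN.
Qed.

Lemma alive0 : alive R X 0 = X 0%N @^-1` ~` [set None].
Proof.
rewrite aliveE; apply/seteqP; split => w /=; first exact.
by move=> X0 k; rewrite leqn0 => /eqP ->.
Qed.

Lemma aliveS n : alive R X n.+1 = alive R X n `&` X n.+1 @^-1` ~` [set None].
Proof.
rewrite !aliveE; apply/seteqP; split => w /=.
  by move=> h; split; [move=> k kn; apply: h; exact: leqW|exact: h].
move=> [h hn] k; rewrite leq_eqVlt => /predU1P[->//|]; exact: h.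
Qed.

Lemma past_alive n : past X n (alive R X n).
Proof.
elim: n => [|n ih].
  rewrite alive0.
  rewrite -[X in past _ _ X]setTI.
  apply: (measurable_chain_past (leqnn 0) measurableT).
  exact/measurableC/measurable_set1_None.
rewrite aliveS; apply: (@measurableI _ (pastType n.+1)).
  exact: past_le ih.
rewrite -[X in measurable X]setTI.
apply: (measurable_chain_past (leqnn n.+1) measurableT).
exact/measurableC/measurable_set1_None.
Qed.

Lemma measurable_alive n : measurable (alive R X n).
Proof. by apply: past_sub_measurable; exact: (@past_alive n). Qed.

Local Open Scope ereal_scope.

Lemma measurable_step (h : option E -> \bar R) :
  measurable_fun setT h -> (forall y, 0 <= h y) ->
  measurable_fun setT (fun v => \int[P v]_w h (X 1%N w)).
Proof.
move=> mh h0; apply: (@measurable_fun_integral_kernel _ _ _ _ R P) => //.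
- by move=> U mU; exact: measurable_kernel.
- by apply: measurableT_comp => //; exact: (chain_measurable mc).
Qed.

Lemma step_ge0 (h : option E -> \bar R) v :
  (forall y, 0 <= h y) -> 0 <= \int[P v]_w h (X 1%N w).
Proof. by move=> h0; apply: integral_ge0. Qed.

(** For an indicator [h] this is [chain_markov]; both sides are additive, homogeneous and continuous
    along increasing sequences in [h]. *)
Lemma markov_set x n F (h : option E -> \bar R) : past X n F ->
  measurable_fun setT h -> (forall y, 0 <= h y) ->
  \int[P x]_(w in F) h (X n.+1 w) =
  \int[P x]_(w in F) \int[P (X n w)]_w' h (X 1%N w').
Proof.
move=> pF; have mF := past_sub_measurable pF.
have mX k := chain_measurable mc k.
have mXh k (g : option E -> \bar R) : measurable_fun setT g ->
    measurable_fun F (g \o X k).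
  move=> mg; apply: (@measurable_funS _ _ _ _ setT) => //.
  exact: measurableT_comp.
have mS k (g : option E -> \bar R) : measurable_fun setT g ->
    (forall y, 0 <= g y) ->
    measurable_fun F (fun w => \int[P (X k w)]_w' g (X 1%N w')).
  move=> mg g0.
  by apply: (mXh k (fun v => \int[P v]_w' g (X 1%N w'))); exact: measurable_step.
apply: (ge0_measurable_ind (Q := fun h : option E -> \bar R =>
  \int[P x]_(w in F) h (X n.+1 w) =
  \int[P x]_(w in F) \int[P (X n w)]_w' h (X 1%N w'))) h.
- move=> B mB.
  have mXB k : measurable (X k @^-1` B) by rewrite -[_ @^-1` _]setTI; exact: mX.
  transitivity (P x (F `&` X n.+1 @^-1` B)).
    by rewrite setIC -integral_indic//.
  rewrite (chain_markov mc)//; apply: eq_integral => w _.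
  by rewrite -[X in P _ X]setIT -integral_indic//.
- move=> k g k0 mg g0 ih.
  have s0 w : F w -> 0 <= \int[P (X n w)]_w' g (X 1%N w').
    by move=> _; exact: step_ge0.
  rewrite (ge0_integralZl_EFin (P x) mF (fun w _ => g0 _) (mXh n.+1 g mg) k0).
  rewrite ih -(ge0_integralZl_EFin (P x) mF s0 (mS n g mg g0) k0).
  apply: eq_integral => w _; rewrite ge0_integralZl_EFin//.
  exact: measurableT_comp.
- move=> g h mg g0 mh h0 ihg ihh.
  have s0 (u : option E -> \bar R) w : (forall y, 0 <= u y) -> F w ->
      0 <= \int[P (X n w)]_w' u (X 1%N w').
    by move=> u0 _; exact: step_ge0.
  rewrite (ge0_integralD (P x) mF (fun w _ => g0 _) (mXh n.+1 g mg)
    (fun w _ => h0 _) (mXh n.+1 h mh)).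
  rewrite ihg ihh -(ge0_integralD (P x) mF (fun w => s0 g w g0) (mS n g mg g0)
    (fun w => s0 h w h0) (mS n h mh h0)).
  apply: eq_integral => w _; rewrite ge0_integralD//; exact: measurableT_comp.
- move=> g mg g0 ndg ih.
  rewrite (monotone_convergence (P x) mF (g' := fun k w => g k (X n.+1 w)))//;
    [|by move=> k; exact: (mXh n.+1)].
  under eq_fun do rewrite ih.
  rewrite -(monotone_convergence (P x) mF
     (g' := fun k w => \int[P (X n w)]_w' g k (X 1%N w')))//.
  + apply: eq_integral => w _.
    rewrite (monotone_convergence (P (X n w)) measurableT
      (g' := fun k w => g k (X 1%N w)))//.
    by move=> k; exact: measurableT_comp.
  + by move=> k; exact: mS.
  + by move=> k w _; exact: step_ge0.
  + move=> w _ k l kl; apply: ge0_le_integral => //.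
    * exact: measurableT_comp.
    * exact: measurableT_comp.
    * by move=> w' _; exact: ndg.
Qed.

End chain.

(** The case at stake is u = +oo: either the sequence is identically 0, or from its first positive
    term on all products equal +oo. *)
Lemma limeMr_ge0 (R : realType) (a : nat -> \bar R) (u : \bar R) :
  nondecreasing_seq a -> (forall n, 0 <= a n)%E -> (0 <= u)%E ->
  limn (fun n => a n * u)%E = (limn a * u)%E.
Proof.
move=> nda a0; case: u => [r| |//] u0.
  by rewrite limeMr//; exact: ereal_nondecreasing_is_cvgn.
have [aE|/existsNP[N /eqP aN]] := pselect (forall n, a n = 0%E).
  under eq_fun do rewrite aE mul0e; rewrite (_ : a = cst 0) ?lim_cst ?mul0e//.
  exact/funext.
have aN0 : (0 < a N)%E by rewrite lt0e aN a0.
rewrite gt0_muley; last first.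
  apply: (lt_le_trans aN0); apply: lime_ge.
    exact: ereal_nondecreasing_is_cvgn.
  by exists N => // n /= Nn; exact: nda.
apply/cvg_lim => //; apply: cvg_near_cst.
exists N => // n /= Nn; rewrite gt0_muley//.
by apply: (lt_le_trans aN0); exact: nda.
Qed.

(** * Killed expectations with weights known at time n *)

Section evaluation.
Context d d' (R : realType) (E : measurableType d) (Om : measurableType d').
Variables (P : R.-pker (option E) ~> Om) (X : nat -> Om -> option E).
Hypothesis mc : absorbed_markov_chain P X.

Local Notation pastType n := (g_sigma_algebraType
  (\bigcup_(k in [set k | (k <= n)%N])
        preimage_set_system setT (X k) (@measurable _ (option E)))).
Local Open Scope ereal_scope.

(** Taking out what is known, without conditional expectations: integrals that agree on all past
    events still agree after multiplication by a past-measurable weight, infinite values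
    included. *)
Lemma past_weighted_integral x n F (h1 h2 Phi : Om -> \bar R) : past X n F ->
  measurable_fun setT h1 -> (forall w, 0 <= h1 w) ->
  measurable_fun setT h2 -> (forall w, 0 <= h2 w) ->
  (forall G, past X n G ->
    \int[P x]_(w in G) h1 w = \int[P x]_(w in G) h2 w) ->
  measurable_fun setT (Phi : pastType n -> \bar R) -> (forall w, 0 <= Phi w) ->
  \int[P x]_(w in F) (Phi w * h1 w) = \int[P x]_(w in F) (Phi w * h2 w).
Proof.
move=> pF mh1 h10 mh2 h20 h12.
have mF := past_sub_measurable mc pF.
have mT (u : Om -> \bar R) : measurable_fun setT u -> measurable_fun F u.
  by move=> mu; apply: (@measurable_funS _ _ _ _ setT).
have mM (g : pastType n -> \bar R) (u : Om -> \bar R) : measurable_fun setT g ->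
    measurable_fun setT u -> measurable_fun F (fun w : Om => g w * u w).
  move=> /(measurable_fun_past mc) mg mu.
  by apply: mT; exact: emeasurable_funM.
have M0 (g : pastType n -> \bar R) (u : Om -> \bar R) :
    (forall w, 0 <= g w) -> (forall w, 0 <= u w) ->
    forall w, F w -> 0 <= g w * u w.
  by move=> g0 u0 w _; exact: mule_ge0.
apply: (ge0_measurable_ind (Q := fun Phi : pastType n -> \bar R =>
  \int[P x]_(w in F) (Phi w * h1 w) = \int[P x]_(w in F) (Phi w * h2 w))) Phi.
- move=> G pG.
  have GE (u : Om -> \bar R) :
      \int[P x]_(w in F) ((\1_G w)%:E * u w) = \int[P x]_(w in F `&` G) u w.
    rewrite integral_mkcondr; apply: eq_integral => w _.
    rewrite patchE indicE; case: ifPn => wG; first by rewrite mul1e.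
    by rewrite mul0e.
  rewrite !GE; apply: h12; exact: (@measurableI _ (pastType n)).
- move=> k g k0 mg g0 ih.
  under eq_integral do rewrite -muleA.
  under [RHS]eq_integral do rewrite -muleA.
  rewrite (ge0_integralZl_EFin (P x) mF (M0 g h1 g0 h10) (mM g h1 mg mh1) k0).
  by rewrite (ge0_integralZl_EFin (P x) mF (M0 g h2 g0 h20) (mM g h2 mg mh2) k0) ih.
- move=> g h mg g0 mh h0 ihg ihh.
  under eq_integral do rewrite ge0_muleDl//.
  under [RHS]eq_integral do rewrite ge0_muleDl//.
  rewrite (ge0_integralD (P x) mF (M0 g h1 g0 h10) (mM g h1 mg mh1)
    (M0 h h1 h0 h10) (mM h h1 mh mh1)).
  by rewrite (ge0_integralD (P x) mF (M0 g h2 g0 h20) (mM g h2 mg mh2)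
    (M0 h h2 h0 h20) (mM h h2 mh mh2)) ihg ihh.
- move=> g mg g0 ndg ih.
  have limE (u : Om -> \bar R) : measurable_fun setT u -> (forall w, 0 <= u w) ->
      \int[P x]_(w in F) (limn (g ^~ w) * u w) =
      limn (fun k => \int[P x]_(w in F) (g k w * u w)).
    move=> mu u0.
    rewrite -(monotone_convergence (P x) mF (g' := fun k w => g k w * u w)).
    + by apply: eq_integral => w _; rewrite limeMr_ge0.
    + by move=> k; exact: mM.
    + by move=> k; exact: M0.
    + by move=> w _ k l kl; rewrite lee_wpmul2r// ndg.
  rewrite !limE//; congr (limn _); apply/funext => k; exact: ih.
Qed.


(** Survival up to [n.+1] is not an event of the past of [n]; it can be replaced by survival up to
    [n] when the integrand vanishes at the cemetery. *)
Lemma integral_alive (x : option E) n (u : Om -> \bar R) :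
  (forall w, X n.+1 w = None -> u w = 0) ->
  \int[P x]_(w in alive R X n.+1) u w = \int[P x]_(w in alive R X n) u w.
Proof.
move=> u0; rewrite aliveS integral_mkcondr; apply: eq_integral => w _.
rewrite patchE; case: ifPn => // /negP; rewrite in_setE/= => nN.
by rewrite u0//; exact: contrapT.
Qed.

Lemma integral_alive0 (y : E) (u : Om -> \bar R) :
  measurable_fun setT u -> (forall w, 0 <= u w) ->
  \int[P (Some y)]_(w in alive R X 0) u w = \int[P (Some y)]_w u w.
Proof.
move=> mu u0.
have m0 : measurable (alive R X 0) := measurable_alive mc 0.
rewrite (@ge0_negligible_integral _ _ _ (P (Some y)) setT (~` alive R X 0) u)//.
- by rewrite setTD setCK.
- exact: measurableC.
- rewrite alive0 preimage_setC setCK.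
  rewrite (chain_start mc); last exact: measurable_set1_None.
  by rewrite diracE memNset.
Qed.

Lemma Psg1E (h : E -> \bar R) y : measurable_fun setT h -> (forall z, 0 <= h z) ->
  Psg P X 1 h y = \int[P (Some y)]_w oapp h 0 (X 1%N w).
Proof.
move=> mh h0; rewrite /Psg integral_alive; last by move=> w ->.
rewrite integral_alive0//; last by move=> w; case: (X 1%N w).
apply: measurableT_comp; first exact: measurable_fun_oapp.
exact: (chain_measurable mc).
Qed.

Lemma measurable_oapp_chain (h : E -> \bar R) n : measurable_fun setT h ->
  measurable_fun setT (fun w => oapp h 0 (X n w)).
Proof.
move=> mh; apply: (@measurableT_comp _ _ _ _ _ _ (oapp h 0) _ (X n)).
  exact: measurable_fun_oapp.
exact: (chain_measurable mc).
Qed.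

Lemma oapp_ge0 T (h : T -> \bar R) o : (forall z, 0 <= h z) -> 0 <= oapp h 0 o.
Proof. by move=> h0; case: o. Qed.

(* E_x[Phi h(X_n); n < tau] *)
Definition killed_expectation n (Phi : Om -> R) (h : E -> \bar R) (x : E) : \bar R :=
  \int[P (Some x)]_(w in alive R X n) ((Phi w)%:E * oapp h 0 (X n w)).

Local Notation ev := killed_expectation.

Lemma ev1 n h : ev n (fun=> 1%R) h = Psg P X n h.
Proof.
by apply/funext => x; apply: eq_integral => w _; rewrite mul1e.
Qed.

Section ev.
Variables (n : nat) (Phi : Om -> R).
Hypotheses (mPhi : measurable_fun setT Phi) (Phi0 : forall w, (0 <= Phi w)%R).
Implicit Types h : E -> \bar R.

Let mu h : measurable_fun setT h ->
  measurable_fun setT (fun w => (Phi w)%:E * oapp h 0 (X n w)).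
Proof.
move=> mh; apply: emeasurable_funM; first exact/measurable_EFinP.
exact: measurable_oapp_chain.
Qed.

Let mua h : measurable_fun setT h ->
  measurable_fun (alive R X n) (fun w => (Phi w)%:E * oapp h 0 (X n w)).
Proof. by move=> mh; apply: measurable_funS (mu mh). Qed.

Let u0 h : (forall x, 0 <= h x) ->
  forall w, 0 <= (Phi w)%:E * oapp h 0 (X n w).
Proof. by move=> h0 w; rewrite mule_ge0 ?lee_fin//; exact: oapp_ge0. Qed.

Lemma ev_ge0 h x : (forall x, 0 <= h x) -> 0 <= ev n Phi h x.
Proof. by move=> h0; apply: integral_ge0 => w _; exact: u0. Qed.

Lemma measurable_ev h : measurable_fun setT h -> (forall x, 0 <= h x) ->
  measurable_fun setT (ev n Phi h).
Proof.
move=> mh h0; rewrite /killed_expectation.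
under eq_fun do rewrite integral_mkcond.
apply: (@measurableT_comp _ _ _ _ _ _ (fun v => \int[P v]_w
  ((fun w => (Phi w)%:E * oapp h 0 (X n w)) \_ (alive R X n)) w) _ Some).
  apply: (@measurable_fun_integral_kernel _ _ _ _ R P) => //.
  - by move=> U mU; exact: measurable_kernel.
  - by move=> w; apply: erestrict_ge0 => w' _; exact: u0.
  - apply/(measurable_restrictT _ (measurable_alive mc n)); exact: mua.
exact: measurable_fun_Some.
Qed.

Lemma evD h1 h2 x : measurable_fun setT h1 -> (forall x, 0 <= h1 x) ->
  measurable_fun setT h2 -> (forall x, 0 <= h2 x) ->
  ev n Phi (fun x => h1 x + h2 x) x = ev n Phi h1 x + ev n Phi h2 x.
Proof.
move=> mh1 h10 mh2 h20.
rewrite /killed_expectation -(ge0_integralD (P (Some x)) (measurable_alive mc n)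
  (fun w _ => u0 h10 w) (mua mh1) (fun w _ => u0 h20 w) (mua mh2)).
apply: eq_integral => w _; case: (X n w) => [y|]/=; last by rewrite !mule0 adde0.
by rewrite ge0_muleDr.
Qed.

Lemma evZ k h x : (0 <= k)%R -> measurable_fun setT h -> (forall x, 0 <= h x) ->
  ev n Phi (fun x => k%:E * h x) x = k%:E * ev n Phi h x.
Proof.
move=> k0 mh h0.
rewrite /killed_expectation -(ge0_integralZl_EFin (P (Some x)) (measurable_alive mc n)
  (fun w _ => u0 h0 w) (mua mh) k0).
apply: eq_integral => w _; case: (X n w) => [y|]/=; last by rewrite !mule0.
by rewrite muleCA.
Qed.

End ev.

Lemma ev_addl n (Phi1 Phi2 : Om -> R) h x :
  measurable_fun setT Phi1 -> (forall w, (0 <= Phi1 w)%R) ->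
  measurable_fun setT Phi2 -> (forall w, (0 <= Phi2 w)%R) ->
  measurable_fun setT h -> (forall x, 0 <= h x) ->
  ev n (fun w => Phi1 w + Phi2 w)%R h x = ev n Phi1 h x + ev n Phi2 h x.
Proof.
move=> m1 p1 m2 p2 mh h0.
have mu (Phi : Om -> R) : measurable_fun setT Phi ->
    measurable_fun (alive R X n) (fun w => (Phi w)%:E * oapp h 0 (X n w)).
  move=> mPhi; apply: (@measurable_funS _ _ _ _ setT) => //.
  apply: emeasurable_funM; first exact/measurable_EFinP.
  exact: measurable_oapp_chain.
have u0 (Phi : Om -> R) : (forall w, (0 <= Phi w)%R) -> forall w,
    alive R X n w -> 0 <= (Phi w)%:E * oapp h 0 (X n w).
  by move=> p w _; rewrite mule_ge0 ?lee_fin//; exact: oapp_ge0.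
rewrite /killed_expectation -(ge0_integralD (P (Some x)) (measurable_alive mc n)
  (u0 _ p1) (mu _ m1) (u0 _ p2) (mu _ m2)).
by apply: eq_integral => w _; rewrite EFinD ge0_muleDl ?lee_fin.
Qed.

(** The weight is known at time [n], so integrating out the last step replaces [h] by [Psg 1 h]. *)
Lemma evSr n (Phi : Om -> R) h x :
  measurable_fun setT (Phi : pastType n -> R) -> (forall w, (0 <= Phi w)%R) ->
  measurable_fun setT h -> (forall x, 0 <= h x) ->
  ev n.+1 Phi h x = ev n Phi (Psg P X 1 h) x.
Proof.
move=> mPhi Phi0 mh h0.
have mh' : measurable_fun setT (oapp h 0 : option E -> \bar R).
  exact: measurable_fun_oapp.
have h0' (o : option E) : 0 <= oapp h 0 o by exact: oapp_ge0.
rewrite /killed_expectation integral_alive; last by move=> w ->; rewrite mule0.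
rewrite (@past_weighted_integral (Some x) n (alive R X n)
  (fun w => oapp h 0 (X n.+1 w))
  (fun w => \int[P (X n w)]_w' oapp h 0 (X 1%N w')) (fun w => (Phi w)%:E)).
- apply: eq_integral => w; rewrite in_setE aliveE => /(_ n (leqnn n)).
  by case: (X n w) => [y|]//= _; rewrite Psg1E.
- exact: past_alive.
- exact: measurable_oapp_chain.
- by move=> w; exact: oapp_ge0.
- apply: (@measurableT_comp _ _ _ _ _ _
    (fun v => \int[P v]_w' oapp h 0 (X 1%N w')) _ (X n)).
    exact: (measurable_step mc).
  exact: (chain_measurable mc).
- by move=> w; exact: step_ge0.
- by move=> G pG; exact: (markov_set mc).
- exact/measurable_EFinP.
- by move=> w; rewrite lee_fin.
Qed.

End evaluation.

(** * Killed moments of the additive functional *)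

Section moments.
Context d d' (R : realType) (E : measurableType d) (Om : measurableType d').
Variables (P : R.-pker (option E) ~> Om) (X : nat -> Om -> option E).
Hypothesis mc : absorbed_markov_chain P X.

Local Notation pastType n := (g_sigma_algebraType
  (\bigcup_(k in [set k | (k <= n)%N])
        preimage_set_system setT (X k) (@measurable _ (option E)))).

Local Notation ev := (killed_expectation P X).
Local Notation Psg := (Psg P X).

(** The class preserved by all operators below; within it no integral needs an integrability
    condition. *)
Definition nnmeas (h : E -> \bar R) :=
  measurable_fun setT h /\ (forall x, (0 <= h x)%E).

Variables (f : E -> R) (M : R).
Hypotheses (mf : measurable_fun setT f) (f0 : forall x, 0 <= f x)
  (fM : forall x, f x <= M) (M0 : 0 <= M).

(** The sum stops before time [n], so [partial_sum n.+1] is known at time [n] and is a legitimate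
    weight for [evSr]. *)
Definition partial_sum n w : R := \sum_(m < n) oapp f 0 (X m w).
Local Notation S := partial_sum.

Lemma partial_sumS n w : S n.+1 w = S n w + oapp f 0 (X n w).
Proof. by rewrite /partial_sum big_ord_recr. Qed.

Lemma oappf_ge0 (o : option E) : 0 <= oapp f 0 o.
Proof. by case: o. Qed.

Lemma oappf_le (o : option E) : oapp f 0 o <= M.
Proof. by case: o. Qed.

Lemma partial_sum_ge0 n w : 0 <= S n w.
Proof. by apply: sumr_ge0 => m _; exact: oappf_ge0. Qed.

Lemma partial_sum_le n w : S n w <= n%:R * M.
Proof.
apply: (@le_trans _ _ (\sum_(m < n) M)).
  by apply: ler_sum => m _; exact: oappf_le.
by rewrite sumr_const card_ord mulr_natl.
Qed.

Lemma measurable_partial_sum_past n k : (n <= k.+1)%N ->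
  measurable_fun setT (S n : pastType k -> R).
Proof.
elim: n => [|n ih] nk.
  rewrite (_ : S 0 = fun=> 0)//; apply/funext => w; by rewrite /partial_sum big_ord0.
rewrite (_ : S n.+1 = fun w => S n w + oapp f 0 (X n w)).
  apply: measurable_funD; first by apply: ih; exact: ltnW.
  have mo : measurable_fun setT (oapp f 0 : option E -> R).
    exact: measurable_fun_oapp.
  exact: (measurableT_comp mo (@measurable_chain_past _ _ _ _ X k n nk)).
by apply/funext => w; rewrite partial_sumS.
Qed.

Lemma measurable_partial_sum n : measurable_fun setT (S n : Om -> R).
Proof.
exact: (measurable_fun_past mc (measurable_partial_sum_past (leqnSn n))).
Qed.

Definition moment1 n h := ev n (S n) h.
Definition moment2 n h := ev n (fun w => S n w ^+ 2) h.

Local Notation M1 := moment1.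
Local Notation M2 := moment2.

Lemma measurable_partial_sum2 n : measurable_fun setT (fun w => S n w ^+ 2).
Proof. by apply: measurable_funX; exact: measurable_partial_sum. Qed.

Lemma measurable_partial_sum2_past n :
  measurable_fun setT ((fun w => S n.+1 w ^+ 2) : pastType n -> R).
Proof. by apply: measurable_funX; exact: measurable_partial_sum_past. Qed.

Local Open Scope ereal_scope.

Definition fmul h (y : E) : \bar R := (f y)%:E * h y.

Lemma nnmeas_fmul h : nnmeas h -> nnmeas (fmul h).
Proof.
move=> [mh h0]; split; last by move=> x; rewrite mule_ge0// lee_fin.
by apply: emeasurable_funM => //; exact/measurable_EFinP.
Qed.

Lemma nnmeas_add h1 h2 :
  nnmeas h1 -> nnmeas h2 -> nnmeas (fun x => h1 x + h2 x).
Proof.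
move=> [m1 h1_ge0] [m2 h2_ge0]; split; first exact: emeasurable_funD.
by move=> x; rewrite adde_ge0.
Qed.

Lemma nnmeas_scale (k : R) h :
  (0 <= k)%R -> nnmeas h -> nnmeas (fun x => k%:E * h x).
Proof.
move=> k0 [m h0]; split; last by move=> x; rewrite mule_ge0.
exact: measurable_funeM.
Qed.

Lemma nnmeas_ev n (Phi : Om -> R) h : measurable_fun setT Phi ->
  (forall w, (0 <= Phi w)%R) -> nnmeas h -> nnmeas (ev n Phi h).
Proof.
by move=> mPhi Phi0 [mh h0]; split; [exact: measurable_ev|
  move=> x; exact: ev_ge0].
Qed.

Lemma nnmeas_Psg n h : nnmeas h -> nnmeas (Psg n h).
Proof. by rewrite -ev1; apply: nnmeas_ev. Qed.

Lemma nnmeas_M1 n h : nnmeas h -> nnmeas (M1 n h).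
Proof.
apply: nnmeas_ev; [exact: measurable_partial_sum|exact: partial_sum_ge0].
Qed.

Lemma nnmeas_M2 n h : nnmeas h -> nnmeas (M2 n h).
Proof.
by apply: nnmeas_ev => [|w]; [exact: measurable_partial_sum2|exact: sqr_ge0].
Qed.

(** A factor f(X_n) of the weight can be charged to the terminal function instead. *)
Lemma ev_fmul n (Phi : Om -> R) h x :
  ev n (fun w => Phi w * oapp f 0 (X n w))%R h x = ev n Phi (fmul h) x.
Proof.
apply: eq_integral => w _; rewrite /fmul.
by case: (X n w) => [y|]/=; rewrite ?mulr0 ?mule0 // EFinM muleA.
Qed.

Lemma PsgSr n h : nnmeas h -> Psg n.+1 h = Psg n (Psg 1 h).
Proof.
by move=> [mh h0]; apply/funext => x; rewrite -ev1 evSr// ev1.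
Qed.

Lemma Psg0 h : nnmeas h -> Psg 0 h = h.
Proof.
move=> [mh h0]; apply/funext => x; rewrite /Defs.Psg integral_alive0//; last 2 first.
- exact: (measurable_oapp_chain mc).
- by move=> w; exact: oapp_ge0.
have mo : measurable_fun setT (oapp h 0 : option E -> \bar R).
  exact: measurable_fun_oapp.
have mX0 := chain_measurable mc 0.
(* By [chain_start] the law of X_0 is the Dirac mass at the starting point. *)
transitivity (\int[pushforward (P (Some x)) (X 0%N)]_y oapp h 0 y).
  rewrite (ge0_integral_pushforward mX0)//.
  by move=> y _; exact: oapp_ge0.
rewrite (@eq_measure_integral _ _ _ _
  (dirac (Some x) : {measure set (option E) -> \bar R})).
  by rewrite integral_dirac//= diracT mul1e.
by move=> A mA _; exact: (chain_start mc).
Qed.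

Lemma PsgD n l h : nnmeas h -> Psg (n + l) h = Psg n (Psg l h).
Proof.
elim: l h => [|l ih] h nh; first by rewrite addn0 Psg0.
by rewrite addnS (PsgSr (n + l) nh) (ih _ (nnmeas_Psg 1 nh)) (PsgSr l nh).
Qed.

Lemma M1S n h : nnmeas h ->
  M1 n.+1 h = fun x => M1 n (Psg 1 h) x + Psg n (fmul (Psg 1 h)) x.
Proof.
move=> nh; have [mh h0] := nh; have [mP P0] := nnmeas_Psg 1 nh.
have mSn := measurable_partial_sum n.
have mfX : measurable_fun setT (fun w : Om => oapp f 0%R (X n w)).
  apply: (@measurableT_comp _ _ _ _ _ _ (oapp f 0%R) _ (X n)).
    exact: measurable_fun_oapp.
  exact: (chain_measurable mc).
apply/funext => x; rewrite /moment1 evSr//; last 2 first.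
- exact: measurable_partial_sum_past.
- exact: partial_sum_ge0.
rewrite (_ : S n.+1 = fun w => S n w + oapp f 0 (X n w))%R; last first.
  by apply/funext => w; rewrite partial_sumS.
rewrite ev_addl//; [|exact: partial_sum_ge0|by move=> w; exact: oappf_ge0].
congr (_ + _); rewrite -(@ev1 _ _ _ _ _ P X n) -ev_fmul; congr (ev _ _ _ _).
by apply/funext => w; rewrite mul1r.
Qed.

Lemma M2S n h : nnmeas h ->
  M2 n.+1 h = fun x => M2 n (Psg 1 h) x + 2%:E * M1 n (fmul (Psg 1 h)) x
    + Psg n (fmul (fmul (Psg 1 h))) x.
Proof.
move=> nh; have [mh h0] := nh; have [mP P0] := nnmeas_Psg 1 nh.
have mSn := measurable_partial_sum n.
have mS2 := measurable_partial_sum2 n.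
have Sn0 := partial_sum_ge0 n.
have mfX : measurable_fun setT (fun w : Om => oapp f 0%R (X n w)).
  apply: (@measurableT_comp _ _ _ _ _ _ (oapp f 0%R) _ (X n)).
    exact: measurable_fun_oapp.
  exact: (chain_measurable mc).
have fX0 w : (0 <= oapp f 0 (X n w))%R := oappf_ge0 (X n w).
have mSf : measurable_fun setT (fun w => S n w * oapp f 0%R (X n w))%R.
  exact: measurable_funM.
have Sf0 w : (0 <= S n w * oapp f 0 (X n w))%R by exact: mulr_ge0.
have mff : measurable_fun setT (fun w => oapp f 0 (X n w) * oapp f 0 (X n w))%R.
  exact: measurable_funM.
apply/funext => x; rewrite /moment2 evSr//; last 2 first.
- exact: measurable_partial_sum2_past.
- by move=> w; exact: sqr_ge0.
(* The double product is written as a sum of two equal terms, so that additivity in the weight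
   produces the factor 2. *)
rewrite (_ : (fun w => S n.+1 w ^+ 2) = fun w => S n w ^+ 2 +
  (S n w * oapp f 0 (X n w) + S n w * oapp f 0 (X n w)) +
  oapp f 0 (X n w) * oapp f 0 (X n w))%R; last first.
  by apply/funext => w; rewrite partial_sumS; ring.
have D0 w : (0 <= S n w * oapp f 0 (X n w) + S n w * oapp f 0 (X n w))%R.
  exact: addr_ge0.
have mD : measurable_fun setT
    (fun w => S n w * oapp f 0 (X n w) + S n w * oapp f 0 (X n w))%R.
  exact: measurable_funD.
rewrite ev_addl//; first last.
- by move=> w; exact: mulr_ge0.
- by move=> w; rewrite addr_ge0// sqr_ge0.
- exact: measurable_funD.
rewrite ev_addl//; last by move=> w; exact: sqr_ge0.
rewrite ev_addl// !ev_fmul.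
congr (_ + _ + _).
  rewrite -[2%R]/(1 + 1)%R EFinD ge0_muleDl ?lee_fin// mul1e.
  by rewrite /moment1.
rewrite -(@ev1 _ _ _ _ _ P X n) -[in RHS]ev_fmul; congr (ev _ _ _ _).
by apply/funext => w; rewrite mul1r.
Qed.

Lemma M10 h x : M1 0 h x = 0.
Proof.
rewrite /moment1 /killed_expectation; apply: integral0_eq => w _.
by rewrite /partial_sum big_ord0 mul0e.
Qed.

Lemma M20 h x : M2 0 h x = 0.
Proof.
rewrite /moment2 /killed_expectation; apply: integral0_eq => w _.
by rewrite /partial_sum big_ord0 expr0n mul0e.
Qed.

Lemma PsgM1D n h1 h2 x : nnmeas h1 -> nnmeas h2 ->
  Psg n (fun x => h1 x + h2 x) x = Psg n h1 x + Psg n h2 x.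
Proof. by move=> [? ?] [? ?]; rewrite -!(@ev1 _ _ _ _ _ P X) evD. Qed.

Lemma PsgZ n (k : R) h x : (0 <= k)%R -> nnmeas h ->
  Psg n (fun x => k%:E * h x) x = k%:E * Psg n h x.
Proof. by move=> k0 [? ?]; rewrite -!(@ev1 _ _ _ _ _ P X) evZ. Qed.

Lemma M1_add n h1 h2 x : nnmeas h1 -> nnmeas h2 ->
  M1 n (fun x => h1 x + h2 x) x = M1 n h1 x + M1 n h2 x.
Proof.
move=> [? ?] [? ?]; rewrite /moment1 evD//; [|exact: partial_sum_ge0].
exact: measurable_partial_sum.
Qed.

Lemma M1Z n (k : R) h x : (0 <= k)%R -> nnmeas h ->
  M1 n (fun x => k%:E * h x) x = k%:E * M1 n h x.
Proof.
move=> k0 [? ?]; rewrite /moment1 evZ//; [|exact: partial_sum_ge0].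
exact: measurable_partial_sum.
Qed.

(** S_(n+l) is cut at time [n]: either its first part is followed by [l] steps of the semigroup, or
    its second part is started afresh from X_n. The induction is on [l] because [evSr] acts on the
    last step. *)
Lemma M1D n l h : nnmeas h ->
  M1 (n + l) h = fun x => M1 n (Psg l h) x + Psg n (M1 l h) x.
Proof.
elim: l h => [|l ih] h nh.
  rewrite addn0; apply/funext => x; rewrite Psg0// (_ : M1 0 h = fun=> 0).
    rewrite /Defs.Psg integral0_eq ?adde0// => w _; by case: (X n w).
  by apply/funext => y; rewrite M10.
have nP1 := nnmeas_Psg 1 nh.
apply/funext => x; rewrite addnS M1S// ih// -PsgSr// PsgD; last exact: nnmeas_fmul.
rewrite -addeA; congr (_ + _); rewrite -PsgM1D ?M1S//; first exact: nnmeas_M1.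
exact/nnmeas_Psg/nnmeas_fmul.
Qed.

(** The same cut for the square; the double product becomes the nested first moment. *)
Lemma M2D n l h : nnmeas h ->
  M2 (n + l) h = fun x => M2 n (Psg l h) x + 2%:E * M1 n (M1 l h) x
    + Psg n (M2 l h) x.
Proof.
elim: l h => [|l ih] h nh.
  rewrite addn0; apply/funext => x; rewrite Psg0// (_ : M1 0 h = fun=> 0).
    rewrite (_ : M2 0 h = fun=> 0); last by apply/funext => y; rewrite M20.
    rewrite /moment1 /Defs.Psg /killed_expectation.
    rewrite [X in _ + _ * X]integral0_eq; last first.
      by move=> w _; case: (X n w); rewrite /= mule0.
    rewrite mule0 adde0 integral0_eq ?adde0// => w _; by case: (X n w).
  by apply/funext => y; rewrite M10.
have nP1 := nnmeas_Psg 1 nh; have nf := nnmeas_fmul nP1.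
have nff := nnmeas_fmul nf.
have n1 := nnmeas_M1 l nP1; have n1f := nnmeas_M1 l nf.
have n2 := nnmeas_M2 l nP1; have nPf := nnmeas_Psg l nf.
have nPff := nnmeas_Psg l nff.
apply/funext => x.
rewrite addnS (M2S (n + l) nh).
rewrite (ih _ nP1).
rewrite (M1D n l nf).
rewrite (PsgD n l nff).
rewrite -(PsgSr l nh) (M1S l nh).
rewrite (M2S l nh).
have n2f := @nnmeas_scale 2%R _ (ler0n R 2) n1f.
rewrite (M1_add n x n1 nPf).
rewrite (PsgM1D n x (nnmeas_add n2 n2f) nPff) (PsgM1D n x n2 n2f).
rewrite (PsgZ n x (ler0n R 2) n1f).
have n0 h' y : nnmeas h' -> 0 <= h' y by case.
rewrite (@ge0_muleDr _ 2%:E (M1 n (Psg l (fmul (Psg 1 h))) x)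
  (Psg n (M1 l (fmul (Psg 1 h))) x) (n0 _ x (nnmeas_M1 n nPf))
  (n0 _ x (nnmeas_Psg n n1f))).
rewrite (@ge0_muleDr _ 2%:E (M1 n (M1 l (Psg 1 h)) x)
  (M1 n (Psg l (fmul (Psg 1 h))) x) (n0 _ x (nnmeas_M1 n n1))
  (n0 _ x (nnmeas_M1 n nPf))).
have reassoc (a b c u v z : \bar R) :
    a + b + c + (u + v) + z = a + (b + u) + (c + v + z).
  by rewrite -!addeA (addeCA c).
exact: reassoc.
Qed.

(** Expansion over the time at which [f] is evaluated. With n = t it links the block mean to the
    announced limit. *)
Lemma M1_sum n h x : nnmeas h ->
  M1 n h x = \sum_(l < n) Psg l (fmul (Psg (n - l) h)) x.
Proof.
elim: n h => [|n ih] h nh; first by rewrite big_ord0 M10.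
have sumE : \sum_(l < n) Psg l (fmul (Psg (n - l) (Psg 1 h))) x =
    \sum_(l < n) Psg l (fmul (Psg (n.+1 - l) h)) x.
  apply: eq_bigr => l _.
  by rewrite -(PsgSr (n - l) nh) subSn// ltnW.
rewrite big_ord_recr -sumE -(ih _ (nnmeas_Psg 1 nh)).
rewrite [LHS](_ : _ = M1 n (Psg 1 h) x + Psg n (fmul (Psg 1 h)) x).
  by rewrite -[(n.+1 - _)%N]/(n.+1 - n)%N (subSnn n).
by rewrite (M1S n nh).
Qed.

Lemma ev_lel n (Phi : Om -> R) (K : R) h x : measurable_fun setT Phi ->
  (forall w, (0 <= Phi w)%R) -> (forall w, (Phi w <= K)%R) -> (0 <= K)%R ->
  nnmeas h -> ev n Phi h x <= K%:E * Psg n h x.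
Proof.
move=> mPhi Phi0 PhiK K0 [mh h0].
have mu (F : Om -> R) : measurable_fun setT F ->
    measurable_fun (alive R X n) (fun w => (F w)%:E * oapp h 0 (X n w)).
  move=> mF; apply: (@measurable_funS _ _ _ _ setT) => //.
  apply: emeasurable_funM; first exact/measurable_EFinP.
  exact: (measurable_oapp_chain mc).
rewrite -(@ev1 _ _ _ _ _ P X) -evZ//.
have -> : ev n (fun=> 1%R) (fun y => K%:E * h y) x = ev n (fun=> K) h x.
  apply: eq_integral => w _; rewrite mul1e.
  by case: (X n w) => [y|]//=; rewrite mule0.
apply: (ge0_le_integral (P (Some x)) (measurable_alive mc n) _
  (mu _ mPhi) (mu (fun=> K) (measurable_cst _))).
- by move=> w _; rewrite mule_ge0 ?lee_fin//; exact: oapp_ge0.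
- by move=> w _; rewrite lee_wpmul2r ?lee_fin//; exact: oapp_ge0.
Qed.

Lemma M1_le n h x : nnmeas h -> M1 n h x <= (n%:R * M)%:E * Psg n h x.
Proof.
move=> nh; apply: ev_lel => //.
- exact: measurable_partial_sum.
- exact: partial_sum_ge0.
- exact: partial_sum_le.
- by rewrite mulr_ge0.
Qed.

Lemma M2_le n h x : nnmeas h -> M2 n h x <= ((n%:R * M) ^+ 2)%:E * Psg n h x.
Proof.
move=> nh; apply: ev_lel => //.
- exact: measurable_partial_sum2.
- by move=> w; exact: sqr_ge0.
- move=> w; rewrite lerXn2r ?nnegrE ?partial_sum_ge0//.
  by rewrite mulr_ge0.
  exact: partial_sum_le.
- exact: sqr_ge0.
Qed.

End moments.

(** * Transport of inequalities along the periodic classes *)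

Section periodic.
Context d d' (R : realType) (E : measurableType d) (Om : measurableType d').
Variables (P : R.-pker (option E) ~> Om) (X : nat -> Om -> option E).
Hypothesis mc : absorbed_markov_chain P X.

Local Notation ev := (killed_expectation P X).
Local Notation Psg := (Psg P X).
Local Open Scope ereal_scope.

Lemma nnmeas_indic (B : set E) : measurable B ->
  nnmeas (EFin \o (\1_B : E -> R)).
Proof.
move=> mB; split; first by apply/measurable_EFinP; exact: measurable_indic.
by move=> x; rewrite lee_fin.
Qed.

Lemma nnmeas_cst (r : R) : (0 <= r)%R -> nnmeas (fun _ : E => r%:E).
Proof. by move=> r0; split => // x; rewrite lee_fin. Qed.

Lemma Psg_cst1 n x : Psg n (cst 1) x = P (Some x) (alive R X n).
Proof.
rewrite -[RHS]mul1e -integral_cst; last exact: (measurable_alive mc).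
apply: eq_integral => w; rewrite in_setE aliveE => /(_ n (leqnn n)).
by case: (X n w).
Qed.

Lemma Psg_cst1_le1 n x : Psg n (cst 1) x <= 1.
Proof.
rewrite Psg_cst1 -(@prob_kernel _ _ _ _ _ P (Some x)).
by apply: le_measure; rewrite ?inE//; exact: (measurable_alive mc).
Qed.

Lemma le_ev_supp n (Phi : Om -> R) (B : set E) h1 h2 x :
  measurable_fun setT Phi -> (forall w, (0 <= Phi w)%R) -> measurable B ->
  Psg n (EFin \o \1_(~` B)) x = 0 -> nnmeas h1 -> nnmeas h2 ->
  (forall y, B y -> h1 y <= h2 y) -> ev n Phi h1 x <= ev n Phi h2 x.
Proof.
move=> mPhi Phi0 mB PB0 [mh1 h10] [mh2 h20] h12.
have mu h : measurable_fun setT h ->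
    measurable_fun (alive R X n) (fun w => (Phi w)%:E * oapp h 0 (X n w)).
  move=> mh; apply: (@measurable_funS _ _ _ _ setT) => //.
  apply: emeasurable_funM; first exact/measurable_EFinP.
  exact: (measurable_oapp_chain mc).
have u0 h : (forall x, 0 <= h x) -> forall w, alive R X n w ->
    0 <= (Phi w)%:E * oapp h 0 (X n w).
  by move=> h0 w _; rewrite mule_ge0 ?lee_fin//; exact: oapp_ge0.
have mal := measurable_alive mc n.
have mN : measurable (X n @^-1` (Some @` (~` B))).
  rewrite -[X in measurable X]setTI; apply: (chain_measurable mc) => //.
  rewrite /measurable/= /option_measurable/=.
  rewrite (_ : Some @^-1` _ = ~` B); first exact: measurableC.
  by apply/seteqP; split => y /=; [case=> z ? [<-]|exists y].
apply: (ae_ge0_le_integral mal (u0 _ h10) (mu _ mh1) (u0 _ h20) (mu _ mh2)).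
exists (X n @^-1` (Some @` (~` B)) `&` alive R X n); split.
- exact: measurableI.
- rewrite -integral_indic// -PB0; apply: eq_integral => w; rewrite in_setE => _.
  rewrite indicE; case Xnw : (X n w) => [y|]/=; last first.
    by rewrite memNset//= Xnw => -[].
  rewrite indicE; have [By|nBy] := pselect (B y).
    rewrite !memNset//= => -[z nBz]; rewrite Xnw => -[zy]; apply: nBz.
    by rewrite zy.
  by rewrite !mem_set//=; exists y.
- move=> w /= /not_implyP[aw hw]; split => //; apply: contrapT => nB; apply: hw.
  case Xnw : (X n w) => [y|]/=; last by rewrite !mule0.
  rewrite lee_wpmul2l ?lee_fin//; apply: h12; apply: contrapT => By.
  by apply: nB; exists y.
Qed.

Variables (t : nat) (A : nat -> set E).
Hypothesis per : periodicity_assumption P X t A.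

Lemma period_gt0 : (0 < t)%N. Proof. by case: per. Qed.

Lemma measurable_class i : (i < t)%N -> measurable (A i).
Proof. by case: per => _ + _ _ _; exact. Qed.

Lemma class_cover x : exists2 i, (i < t)%N & A i x.
Proof.
case: per => _ _ _ Acover _; have : setT x by [].
by rewrite -Acover => -[i /= it Aix]; exists i.
Qed.

(** In one step the next class carries the whole surviving mass, so its complement carries none; the
    general case peels off the first step. *)
Lemma Psg_class n i x : (i < t)%N -> A i x ->
  Psg n (EFin \o \1_(~` A ((i + n) %% t)%N)) x = 0.
Proof.
have t0 := period_gt0.
have mA k : measurable (A (k %% t)%N) by apply: measurable_class; rewrite ltn_mod.
have nC k : nnmeas (EFin \o (\1_(~` A (k %% t)%N) : E -> R)).
  by apply: nnmeas_indic; exact: measurableC.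
have step j y : (j < t)%N -> A j y ->
    Psg 1 (EFin \o \1_(~` A ((j + 1) %% t)%N)) y = 0.
  move=> jt Ajy; case: per => _ _ _ _ /(_ j (j.+1 %% t)%N y jt).
  rewrite ltn_mod => /(_ t0 Ajy); rewrite eqxx addn1 => PA.
  have : Psg 1 (cst 1) y = Psg 1 (EFin \o \1_(A (j.+1 %% t)%N)) y +
      Psg 1 (EFin \o \1_(~` A (j.+1 %% t)%N)) y.
    rewrite -(PsgM1D mc)//; last exact: nnmeas_indic.
    congr (Psg 1 _ y); apply/funext => z /=.
    rewrite indicC indicE -EFinD -natrD.
    by case: (z \in _).
  (* Finiteness permits cancelling the surviving mass on both sides. *)
  have fin1 : Psg 1 (cst 1) y \is a fin_num.
    rewrite ge0_fin_numE; first exact: le_lt_trans (Psg_cst1_le1 1 y) (ltry _).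
    by rewrite Psg_cst1.
  rewrite PA -{1}[Psg 1 (cst 1) y]adde0 => /eqP.
  rewrite eq_le => /andP[]; rewrite !leeD2lE// => ? ?.
  by apply/eqP; rewrite eq_le; apply/andP.
elim: n i x => [|n ih] i x it Aix.
  rewrite addn0 modn_small// (Psg0 mc); last first.
    by rewrite -[i in A i](modn_small it).
  by rewrite /= indicE memNset.
have h0 y : A ((i + 1) %% t)%N y ->
    Psg n (EFin \o \1_(~` A ((i + n.+1) %% t)%N)) y <= 0.
  move=> Ay; rewrite (_ : (i + n.+1) %% t = ((i + 1) %% t + n) %% t)%N.
    by rewrite ih// ltn_mod.
  by rewrite modnDml -addnA add1n.
rewrite [LHS](_ : _ = Psg 1 (Psg n (EFin \o \1_(~` A ((i + n.+1) %% t)%N))) x);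
  last by rewrite -(PsgD mc 1 n (nC _)).
apply/eqP; rewrite eq_le; apply/andP; split; last first.
  rewrite -ev1; apply: ev_ge0 => // y; rewrite -ev1; apply: ev_ge0 => //.
  by move=> z; rewrite lee_fin.
apply: (@le_trans _ _ (Psg 1 (fun=> 0) x)); last first.
  by rewrite /Defs.Psg integral0_eq// => w _; case: (X 1%N w).
rewrite -!(@ev1 _ _ _ _ _ P X 1).
apply: (@le_ev_supp _ _ (A ((i + 1) %% t)%N)) => //.
- exact: step.
- exact: nnmeas_Psg.
Qed.

(** Estimates from (H) hold on A_0 only; this integrates them from any class at the times when the
    chain is in A_0. *)
Lemma le_ev_class n i j (Phi : Om -> R) h1 h2 x :
  measurable_fun setT Phi -> (forall w, (0 <= Phi w)%R) ->
  (i < t)%N -> A i x -> ((i + n) %% t = j)%N -> nnmeas h1 -> nnmeas h2 ->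
  (forall y, A j y -> h1 y <= h2 y) -> ev n Phi h1 x <= ev n Phi h2 x.
Proof.
move=> mPhi Phi0 it Aix <- nh1 nh2 h12.
apply: (@le_ev_supp _ _ (A ((i + n) %% t)%N)) => //.
- by apply: measurable_class; rewrite ltn_mod period_gt0.
- exact: Psg_class.
Qed.

End periodic.

(** * The normalised t-step kernel and assumption (H) *)

Section spectral.
Context d d' (R : realType) (E : measurableType d) (Om : measurableType d').
Variables (P : R.-pker (option E) ~> Om) (X : nat -> Om -> option E).
Hypothesis mc : absorbed_markov_chain P X.
Variables (t : nat) (A : nat -> set E).
Hypothesis per : periodicity_assumption P X t A.
Variables (V eta : E -> R) (nu : probability E R) (theta0 C alpha : R).
Hypothesis H : assumptionH P X t (A 0%N) V eta nu theta0 C alpha.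

Local Notation Psg := (Psg P X).

Let t0 : (0 < t)%N := period_gt0 per.
Let mA0 : measurable (A 0%N) := measurable_class per t0.

Lemma V_ge0 x : 0 <= V x.
Proof.
have [Ax|nAx] := pselect (A 0%N x); first exact: le_trans (H_V_ge1 H Ax).
by rewrite (H_V_ext H).
Qed.

Lemma eta_ge0 x : 0 <= eta x.
Proof.
have [Ax|nAx] := pselect (A 0%N x); first exact: (H_eta_ge0 H).
by rewrite (H_eta_ext H).
Qed.

Lemma measurable_fun_ext0 (g : E -> R) : measurable_fun (A 0%N) g ->
  (forall x, ~ A 0%N x -> g x = 0) -> measurable_fun setT g.
Proof.
move=> mg g0; rewrite (_ : g = g \_ (A 0%N)).
  by apply/(measurable_restrictT _ mA0).
apply/funext => x; rewrite patchE; case: ifPn => // /negP.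
by rewrite in_setE => /g0.
Qed.

Lemma nnmeas_V : nnmeas (EFin \o V).
Proof.
split; last by move=> x; rewrite lee_fin V_ge0.
apply/measurable_EFinP; apply: measurable_fun_ext0 (H_V_ext H).
exact: (H_V_measurable H).
Qed.

Lemma nnmeas_eta : nnmeas (EFin \o eta).
Proof.
split; last by move=> x; rewrite lee_fin eta_ge0.
apply/measurable_EFinP; apply: measurable_fun_ext0 (H_eta_ext H).
exact: (H_eta_measurable H).
Qed.

Lemma theta0_gt0 : 0 < theta0. Proof. by case/andP: (H_theta0 H). Qed.
Lemma theta0_le1 : theta0 <= 1. Proof. by case/andP: (H_theta0 H). Qed.
Lemma alpha_gt0 : 0 < alpha. Proof. by case/andP: (H_alpha H). Qed.
Lemma alpha_lt1 : alpha < 1. Proof. by case/andP: (H_alpha H). Qed.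

Lemma thetaX_gt0 n : 0 < theta0 ^- n.
Proof. by rewrite invr_gt0 exprn_gt0// theta0_gt0. Qed.

Lemma thetaX_ge0 n : 0 <= theta0 ^- n. Proof. exact/ltW/thetaX_gt0. Qed.

Local Open Scope ereal_scope.

(* T^k *)
Definition block_kernel k h (x : E) : \bar R :=
  (theta0 ^- (k * t))%:E * Psg (k * t) h x.

Local Notation Tn := block_kernel.

Lemma nnmeas_Tn k h : nnmeas h -> nnmeas (Tn k h).
Proof.
move=> nh; apply: nnmeas_scale; first exact: thetaX_ge0.
exact: nnmeas_Psg.
Qed.

Lemma le_Tn k h1 h2 x : A 0%N x -> nnmeas h1 -> nnmeas h2 ->
  (forall y, A 0%N y -> h1 y <= h2 y) -> Tn k h1 x <= Tn k h2 x.
Proof.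
move=> Ax n1 n2 h12; apply: lee_wpmul2l; first by rewrite lee_fin thetaX_ge0.
rewrite -!(@ev1 _ _ _ _ _ P X).
by apply: (@le_ev_class _ _ _ _ _ _ _ mc _ _ per _ 0%N 0%N) => //; rewrite modnMl.
Qed.

Lemma TnZ k (c : R) h x : (0 <= c)%R -> nnmeas h ->
  Tn k (fun y => c%:E * h y) x = c%:E * Tn k h x.
Proof. by move=> c0 nh; rewrite /block_kernel (PsgZ mc)// muleCA. Qed.

Lemma TnDr k h1 h2 x : nnmeas h1 -> nnmeas h2 ->
  Tn k (fun y => h1 y + h2 y) x = Tn k h1 x + Tn k h2 x.
Proof.
move=> n1 n2; rewrite /block_kernel (PsgM1D mc)// ge0_muleDr//.
- by have [_] := nnmeas_Psg mc (k * t) n1.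
- by have [_] := nnmeas_Psg mc (k * t) n2.
Qed.

Lemma TnD k l h x : nnmeas h -> Tn (k + l) h x = Tn k (Tn l h) x.
Proof.
move=> nh; rewrite /block_kernel mulnDl (PsgD mc)// (PsgZ mc) ?thetaX_ge0//;
  last exact: nnmeas_Psg.
by rewrite exprD invfM EFinM muleA.
Qed.

Lemma nu_V_fin : \int[nu]_x (V x)%:E \is a fin_num.
Proof.
rewrite ge0_fin_numE; first exact: (H_nu_V H).
by apply: integral_ge0 => x _; rewrite lee_fin V_ge0.
Qed.

Lemma le_nu h1 h2 : nnmeas h1 -> nnmeas h2 ->
  (forall y, A 0%N y -> h1 y <= h2 y) -> \int[nu]_x h1 x <= \int[nu]_x h2 x.
Proof.
move=> [m1 h10] [m2 h20] h12.
apply: ae_ge0_le_integral => //.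
exists (~` A 0%N); split; first exact: measurableC.
- by have := probability_setC nu mA0; rewrite (H_nu_A0 H) subee.
- move=> x /= /not_implyP[_ hx] Ax; apply: hx; exact: h12.
Qed.

(** (H) as two inequalities free of subtraction, for functions bounded by a multiple of V on A_0 and
    arbitrary elsewhere. *)
Lemma Tn_cvg k (c : R) h x : A 0%N x -> nnmeas h -> (0 < c)%R ->
  (forall y, A 0%N y -> h y <= (c * V y)%:E) ->
  Tn k h x <= (eta x)%:E * \int[nu]_y h y + (c * C * alpha ^+ k * V x)%:E /\
  (eta x)%:E * \int[nu]_y h y <= Tn k h x + (c * C * alpha ^+ k * V x)%:E.
Proof.
move=> Ax nh c0 hcV; have [mh h0] := nh.
have hfin y : A 0%N y -> h y \is a fin_num.
  by move=> Ay; rewrite ge0_fin_numE//; exact: le_lt_trans (hcV _ Ay) (ltry _).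
(* (H) requires a real function that vanishes off A_0 and is bounded by V. The kernel started in A_0
   and [nu] see only A_0, so [h] and [c * g] give the same values. *)
pose g := ((fun y => fine (h y) / c)%R \_ (A 0%N)).
have gE y : A 0%N y -> g y = (fine (h y) / c)%R by move=> Ay; rewrite /g patchE mem_set.
have g0 y : (0 <= g y)%R.
  rewrite /g patchE; case: ifPn => // _.
  by apply: divr_ge0; [exact: fine_ge0|exact: ltW].
have mg : measurable_fun setT g.
  apply/(measurable_restrictT _ mA0); apply: measurable_funM => //.
  apply: (@measurable_funS _ _ _ _ setT) => //.
  by apply: (measurableT_comp _ mh) => //; exact: measurable_fine.
have ng : nnmeas (EFin \o g).
  by split; [exact/measurable_EFinP|move=> y; rewrite lee_fin].
have ncg : nnmeas (fun y => c%:E * (EFin \o g) y).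
  by apply: nnmeas_scale => //; exact: ltW.
have hg y : A 0%N y -> h y = c%:E * (EFin \o g) y.
  move=> Ay; rewrite /= gE// -EFinM mulrCA mulfV ?gt_eqF// mulr1 fineK//.
  exact: hfin.
have c0' := ltW c0.
have TE : Tn k h x = c%:E * Tn k (EFin \o g) x.
  rewrite -TnZ//; apply/eqP; rewrite eq_le.
  by apply/andP; split; apply: le_Tn => // y Ay; rewrite hg.
have IE : \int[nu]_y h y = c%:E * \int[nu]_y (g y)%:E.
  rewrite -ge0_integralZl_EFin//; [|by move=> y _; rewrite lee_fin|by case: ng].
  by apply/eqP; rewrite eq_le; apply/andP; split; apply: le_nu => // y Ay; rewrite hg.
have gV y : A 0%N y -> (`|g y| <= V y)%R.
  move=> Ay; rewrite ger0_norm// gE// ler_pdivrMr// -lee_fin fineK ?hfin//.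
  by rewrite mulrC; exact: hcV.
have gext y : ~ A 0%N y -> g y = 0%R by move=> nA; rewrite /g patchE memNset.
have := H_cvg H (measurable_funS measurableT (@subsetT _ _) mg) gext gV k Ax.
rewrite -/(Tn k (EFin \o g) x) TE IE.
have If : \int[nu]_y (g y)%:E \is a fin_num.
  rewrite ge0_fin_numE; last by apply: integral_ge0 => y _; rewrite lee_fin.
  apply: le_lt_trans (H_nu_V H); apply: (@le_nu (EFin \o g) (EFin \o V)) => //.
    exact: nnmeas_V.
  by move=> y Ay; rewrite lee_fin (le_trans (ler_norm _))// gV.
have [_ T0] := nnmeas_Tn k ng.
move: (T0 x); rewrite -(fineK If).
case: (Tn k (EFin \o g) x) => [r| |] //.
move: (fine _) => I r0; rewrite -!EFinM -EFinB /= lee_fin ler_norml => /andP[].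
rewrite -!EFinD !lee_fin => ? ?.
have e : (c * C * alpha ^+ k * V x = c * (C * alpha ^+ k * V x))%R by ring.
split; rewrite e; [rewrite mulrCA|rewrite mulrCA]; rewrite -mulrDr ler_pM2l//; lra.
Qed.

End spectral.

(** * Moments over blocks of t steps and their action on eta and V *)

Section block_moments.
Context d d' (R : realType) (E : measurableType d) (Om : measurableType d').
Variables (P : R.-pker (option E) ~> Om) (X : nat -> Om -> option E).
Hypothesis mc : absorbed_markov_chain P X.
Variables (t : nat) (A : nat -> set E).
Hypothesis per : periodicity_assumption P X t A.
Variables (V eta : E -> R) (nu : probability E R) (theta0 C alpha : R).
Hypothesis H : assumptionH P X t (A 0%N) V eta nu theta0 C alpha.
Variables (f : E -> R) (M : R).
Hypotheses (mf : measurable_fun setT f) (f0 : forall x, 0 <= f x)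
  (fM : forall x, f x <= M) (M0 : 0 <= M).

Local Notation Psg := (Psg P X).
Local Notation Tn := (block_kernel P X t theta0).
Local Notation M1 := (moment1 P X f).
Local Notation M2 := (moment2 P X f).

Let t0 : (0 < t)%N := period_gt0 per.
Let th0 n : 0 <= theta0 ^- n := thetaX_ge0 H n.

Local Open Scope ereal_scope.

(* [block_moment1 1] is the operator F, and [block_mean] below is lam. *)
Definition block_moment1 k h (x : E) : \bar R :=
  (theta0 ^- (k * t))%:E * M1 (k * t) h x.
Definition block_moment2 k h (x : E) : \bar R :=
  (theta0 ^- (k * t))%:E * M2 (k * t) h x.

Local Notation Dn := block_moment1.
Local Notation Un := block_moment2.

Lemma nnmeas_Dn k h : nnmeas h -> nnmeas (Dn k h).
Proof. by move=> nh; apply: nnmeas_scale => //; exact: nnmeas_M1. Qed.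

Lemma nnmeas_Un k h : nnmeas h -> nnmeas (Un k h).
Proof. by move=> nh; apply: nnmeas_scale => //; exact: nnmeas_M2. Qed.

Lemma le_Dn k h1 h2 x : A 0%N x -> nnmeas h1 -> nnmeas h2 ->
  (forall y, A 0%N y -> h1 y <= h2 y) -> Dn k h1 x <= Dn k h2 x.
Proof.
move=> Ax n1 n2 h12; apply: lee_wpmul2l; first by rewrite lee_fin.
apply: (@le_ev_class _ _ _ _ _ _ _ mc _ _ per _ 0%N 0%N) => //.
- exact: (measurable_partial_sum mc mf).
- exact: partial_sum_ge0.
- by rewrite modnMl.
Qed.

Lemma DnZ k (c : R) h x : (0 <= c)%R -> nnmeas h ->
  Dn k (fun y => c%:E * h y) x = c%:E * Dn k h x.
Proof. by move=> c0 nh; rewrite /block_moment1 (M1Z mc mf f0)// muleCA. Qed.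

Lemma DnDr k h1 h2 x : nnmeas h1 -> nnmeas h2 ->
  Dn k (fun y => h1 y + h2 y) x = Dn k h1 x + Dn k h2 x.
Proof.
move=> n1 n2; rewrite /block_moment1 (M1_add mc mf f0)// ge0_muleDr//.
- by have [_] := nnmeas_M1 mc mf f0 (k * t) n1.
- by have [_] := nnmeas_M1 mc mf f0 (k * t) n2.
Qed.

Lemma Dn0 h x : Dn 0 h x = 0.
Proof. by rewrite /block_moment1 mul0n M10 mule0. Qed.

Lemma Un0 h x : Un 0 h x = 0.
Proof. by rewrite /block_moment2 mul0n M20 mule0. Qed.

(** A Leibniz rule: the normalisation is multiplicative in the number of blocks, so [M1D] passes to
    the normalised operators. *)
Lemma Dn_add k l h x : nnmeas h -> Dn (k + l) h x = Dn k (Tn l h) x + Tn k (Dn l h) x.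
Proof.
move=> nh; rewrite /block_moment1 /block_kernel mulnDl (M1D mc mf f0)//.
have n1 := nnmeas_Psg mc (l * t) nh; have n2 := nnmeas_M1 mc mf f0 (l * t) nh.
rewrite (M1Z mc mf f0)// (PsgZ mc)// !muleA -!EFinM -invfM -exprD.
have [_ p1] := nnmeas_M1 mc mf f0 (k * t) n1.
have [_ p2] := nnmeas_Psg mc (k * t) n2.
by rewrite (ge0_muleDr _ (p1 x) (p2 x)).
Qed.

Lemma Un_add k l h x : nnmeas h -> Un (k + l) h x =
  Un k (Tn l h) x + 2%:E * Dn k (Dn l h) x + Tn k (Un l h) x.
Proof.
move=> nh; rewrite /block_moment2 /block_moment1 /block_kernel mulnDl (M2D mc mf f0)//.
have n0 := nnmeas_Psg mc (l * t) nh; have n1 := nnmeas_M1 mc mf f0 (l * t) nh.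
have n2 := nnmeas_M2 mc mf (l * t) nh.
have M2Z : M2 (k * t) (fun y => (theta0 ^- (l * t))%:E * Psg (l * t) h y) x =
    (theta0 ^- (l * t))%:E * M2 (k * t) (Psg (l * t) h) x.
  have [m1 p1] := n0; apply: evZ => //; first exact: (measurable_partial_sum2 mc mf).
  by move=> w; exact: sqr_ge0.
rewrite M2Z (M1Z mc mf f0)// (PsgZ mc)//.
have [_ p0] := nnmeas_M2 mc mf (k * t) n0.
have [_ p1] := nnmeas_M1 mc mf f0 (k * t) n1.
have [_ p2] := nnmeas_Psg mc (k * t) n2.
have q1 : 0 <= 2%:E * M1 (k * t) (M1 (l * t) h) x by rewrite mule_ge0.
rewrite (ge0_muleDr _ (adde_ge0 (p0 x) q1) (p2 x)) (ge0_muleDr _ (p0 x) q1).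
set u2 := M2 _ _ x; set u1 := M1 _ _ x; set u0 := Psg _ _ x.
have e : (theta0 ^- (k * t + l * t) = theta0 ^- (k * t) * theta0 ^- (l * t))%R.
  by rewrite exprD invfM.
rewrite e; clearbody u0 u1 u2.
by rewrite !muleA -!EFinM; congr (_ + _%:E * _ + _); ring.
Qed.

Lemma Dn_le k h x : nnmeas h -> Dn k h x <= ((k * t)%:R * M)%:E * Tn k h x.
Proof.
move=> nh; rewrite muleCA; apply: lee_wpmul2l; first by rewrite lee_fin.
exact: M1_le.
Qed.

Lemma Un_le k h x : nnmeas h -> Un k h x <= (((k * t)%:R * M) ^+ 2)%:E * Tn k h x.
Proof.
move=> nh; rewrite muleCA; apply: lee_wpmul2l; first by rewrite lee_fin.
exact: M2_le.
Qed.

(** The pair (a, b) records a main part along eta and an error in units of V; in [lower] the error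
    stands beside [h] to avoid a subtraction. *)
Definition upper h (a b : R) :=
  forall x, A 0%N x -> h x <= (a * eta x + b * V x)%:E.
Definition lower h (a b : R) :=
  forall x, A 0%N x -> (a * eta x)%:E <= h x + (b * V x)%:E.

Lemma eta_le_V : exists2 c : R, (0 < c)%R &
  forall x, A 0%N x -> (eta x <= c * V x)%R.
Proof.
have [c [_ hc]] := H_eta_V H.
(* Boundedness supplies a bound for every number above [c]; this one is also positive. *)
exists (Num.max c 0 + 1)%R; first by rewrite ltr_pwDr// le_max lexx orbT.
move=> x Ax; have V1 := H_V_ge1 H Ax.
have V0 : (0 < V x)%R by exact: lt_le_trans V1.
rewrite -ler_pdivrMr//; apply: le_trans (ler_norm _) _; apply: hc => //.
by rewrite ltr_pwDr// le_max lexx.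
Qed.

Lemma Tn_V : exists2 c : R, (0 < c)%R &
  forall k x, A 0%N x -> Tn k (EFin \o V) x <= (c * V x)%:E.
Proof.
have [ce ce0 eV] := eta_le_V; have nV := nnmeas_V per H.
pose v := fine (\int[nu]_x (V x)%:E).
have v0 : (0 <= v)%R.
  by apply: fine_ge0; apply: integral_ge0 => x _; rewrite lee_fin (V_ge0 H).
(* T^k V is at most eta nu(V) + C V with eta at most [ce] V; the 1 makes the constant positive. *)
exists (ce * v + C + 1)%R.
  by rewrite ltr_wpDl// addr_ge0 ?(H_C H)// mulr_ge0// ltW.
move=> k x Ax.
have [|+ _] := @Tn_cvg _ _ _ _ _ _ _ mc _ _ per _ _ _ _ _ _ H k 1%R _ x Ax nV ltr01.
  by move=> y _; rewrite mul1r.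
move=> /le_trans; apply.
rewrite -(fineK (nu_V_fin H)) -/v -EFinM -EFinD lee_fin mul1r.
have ak : (alpha ^+ k <= 1)%R by rewrite exprn_ile1// ltW ?(alpha_gt0 H) ?(alpha_lt1 H).
have V0 := V_ge0 H x; have C0 := H_C H.
have h1 : (eta x * v <= ce * V x * v)%R by rewrite ler_wpM2r// eV.
have h2 : (C * alpha ^+ k * V x <= C * V x)%R.
  by rewrite ler_wpM2r// ler_piMr.
by lra.
Qed.

Definition block_mean := fine (\int[nu]_x Dn 1 (EFin \o eta) x).

Local Notation lam := block_mean.

Lemma Dn1_V : exists2 c : R, (0 < c)%R &
  forall x, A 0%N x -> Dn 1 (EFin \o V) x <= (c * V x)%:E.
Proof.
have [c c0 TV] := Tn_V; exists ((1 * t)%:R * M * c + 1)%R.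
  by rewrite ltr_wpDl// !mulr_ge0// ltW.
move=> x Ax; apply: le_trans (Dn_le 1 x (nnmeas_V per H)) _.
apply: (@le_trans _ _ (((1 * t)%:R * M)%:E * (c * V x)%:E)).
  by apply: lee_wpmul2l; [rewrite lee_fin mulr_ge0|exact: TV].
by rewrite -EFinM lee_fin mulrDl mulrA mul1r lerDl (V_ge0 H).
Qed.

Lemma Dn1_eta : exists2 c : R, (0 < c)%R &
  forall x, A 0%N x -> Dn 1 (EFin \o eta) x <= (c * V x)%:E.
Proof.
have [ce ce0 eV] := eta_le_V; have [cd cd0 DV] := Dn1_V.
have nV := nnmeas_V per H; have ne := nnmeas_eta per H.
exists (ce * cd)%R; first exact: mulr_gt0.
move=> x Ax.
apply: (@le_trans _ _ (Dn 1 (fun y => ce%:E * (EFin \o V) y) x)).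
  apply: le_Dn => //; first by apply: nnmeas_scale => //; exact: ltW.
rewrite DnZ//; last exact: ltW.
rewrite -mulrA EFinM; apply: lee_wpmul2l; first by rewrite lee_fin ltW.
exact: DV.
Qed.

(** The integral is finite since F eta is bounded by a multiple of V on A_0 and nu(V) is finite. *)
Lemma lamE : \int[nu]_x Dn 1 (EFin \o eta) x = lam%:E.
Proof.
rewrite /block_mean fineK//.
have [c c0 De] := Dn1_eta; have nV := nnmeas_V per H.
have nD := nnmeas_Dn 1 (nnmeas_eta per H); have [_ D0] := nD.
rewrite ge0_fin_numE; last exact: integral_ge0.
apply: (@le_lt_trans _ _ (\int[nu]_x (c%:E * (EFin \o V) x))).
  apply: (le_nu per H nD) => //; apply: nnmeas_scale => //; exact: ltW.
rewrite ge0_integralZl_EFin//; last exact: ltW.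
- by rewrite lte_mul_pinfty ?lee_fin ?(H_nu_V H)// ltW.
- by case: nV.
- by case: nV.
Qed.

Lemma lam_ge0 : (0 <= lam)%R.
Proof.
apply: fine_ge0; apply: integral_ge0 => x _.
by have [_] := nnmeas_Dn 1 (nnmeas_eta per H).
Qed.

Lemma nnmeas_comb (a b : R) : (0 <= a)%R -> (0 <= b)%R ->
  nnmeas (fun y => a%:E * (EFin \o eta) y + b%:E * (EFin \o V) y).
Proof.
move=> a0 b0; apply: nnmeas_add; apply: nnmeas_scale => //.
- exact: (nnmeas_eta per H).
- exact: (nnmeas_V per H).
Qed.

(** T^k F sends eta to lam eta up to alpha^k V, and V to O(V) uniformly in k. Main parts are thus
    multiplied by lam, while old errors grow only by a constant factor. *)
Lemma block_rule : exists2 c : R, (0 < c)%R &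
  forall k h (a b : R), (0 <= a)%R -> (0 <= b)%R -> nnmeas h ->
  (upper h a b -> upper (Tn k (Dn 1 h)) (a * lam) (c * (a * alpha ^+ k + b))) /\
  (lower h a b -> lower (Tn k (Dn 1 h)) (a * lam) (c * (a * alpha ^+ k + b))).
Proof.
have [ct ct0 TV] := Tn_V; have [cd cd0 DV] := Dn1_V.
have [ce ce0 De] := Dn1_eta.
have nV := nnmeas_V per H; have ne := nnmeas_eta per H.
have nDV := nnmeas_Dn 1 nV; have nDe := nnmeas_Dn 1 ne.
have C0 := H_C H; have al0 := ltW (alpha_gt0 H).
have TDV k x : A 0%N x -> Tn k (Dn 1 (EFin \o V)) x <= (cd * ct * V x)%:E.
  move=> Ax; apply: (@le_trans _ _ (Tn k (fun y => cd%:E * (EFin \o V) y) x)).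
    by apply: (le_Tn mc per H) => //; apply: nnmeas_scale => //; exact: ltW.
  rewrite (TnZ mc)//; last exact: ltW.
  rewrite -mulrA EFinM; apply: lee_wpmul2l; first by rewrite lee_fin ltW.
  exact: TV.
(* [ce * C] comes from (H) applied to F eta, [cd * ct] from bounding F V and then T^k V. *)
exists (ce * C + cd * ct)%R; first by rewrite ltr_wpDl ?mulr_gt0// mulr_ge0// ltW.
move=> k h a b a0 b0 nh.
have nDh := nnmeas_Dn 1 nh.
have TDcomb x : Tn k (Dn 1 (fun y => a%:E * (EFin \o eta) y + b%:E * (EFin \o V) y)) x
    = a%:E * Tn k (Dn 1 (EFin \o eta)) x + b%:E * Tn k (Dn 1 (EFin \o V)) x.
  rewrite -(TnZ mc t theta0 k x a0 nDe) -(TnZ mc t theta0 k x b0 nDV).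
  rewrite -(TnDr mc t theta0 k x (nnmeas_scale a0 nDe) (nnmeas_scale b0 nDV)).
  congr (Tn k _ x); apply/funext => y.
  by rewrite DnDr ?DnZ//; exact: nnmeas_scale.
have Te x : A 0%N x ->
    Tn k (Dn 1 (EFin \o eta)) x <= (lam * eta x + ce * C * alpha ^+ k * V x)%:E /\
    (lam * eta x)%:E <= Tn k (Dn 1 (EFin \o eta)) x + (ce * C * alpha ^+ k * V x)%:E.
  move=> Ax.
  have := @Tn_cvg _ _ _ _ _ _ _ mc _ _ per _ _ _ _ _ _ H k ce _ x Ax nDe ce0 De.
  by rewrite lamE -EFinM -EFinD (mulrC lam).
have V0 x := V_ge0 H x.
have b_le x : (a * (ce * C * alpha ^+ k * V x) + b * (cd * ct * V x) <=
    (ce * C + cd * ct) * (a * alpha ^+ k + b) * V x)%R.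
  rewrite -subr_ge0; have -> : ((ce * C + cd * ct) * (a * alpha ^+ k + b) * V x -
    (a * (ce * C * alpha ^+ k * V x) + b * (cd * ct * V x)) =
    (ce * C * b + cd * ct * (a * alpha ^+ k)) * V x)%R by ring.
  rewrite mulr_ge0// addr_ge0// !mulr_ge0 ?exprn_ge0//; exact: ltW.
split=> hub x Ax.
- apply: (@le_trans _ _ (Tn k (Dn 1
     (fun y => a%:E * (EFin \o eta) y + b%:E * (EFin \o V) y)) x)).
    apply: (le_Tn mc per H) => //; first by apply: nnmeas_Dn; exact: nnmeas_comb.
    move=> y Ay; apply: le_Dn => //; exact: nnmeas_comb.
  rewrite TDcomb.
  apply: (@le_trans _ _ (a%:E * (lam * eta x + ce * C * alpha ^+ k * V x)%:E +
      b%:E * (cd * ct * V x)%:E)).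
    apply: leeD; apply: lee_wpmul2l => //; first by case: (Te x Ax).
    exact: TDV.
  rewrite -!EFinM -EFinD lee_fin; have := b_le x; lra.
(* The operators are applied to the inequality a eta <= h + b V, which involves nonnegative
   functions only. *)
- have nbV : nnmeas (fun y => b%:E * (EFin \o V) y) by exact: nnmeas_scale.
  have nhb : nnmeas (fun y => h y + b%:E * (EFin \o V) y) by exact: nnmeas_add.
  have nae : nnmeas (fun y => a%:E * (EFin \o eta) y) by exact: nnmeas_scale.
  have h1 : a%:E * Tn k (Dn 1 (EFin \o eta)) x <=
      Tn k (Dn 1 h) x + b%:E * Tn k (Dn 1 (EFin \o V)) x.
    rewrite -(TnZ mc t theta0 k x a0 nDe) -(TnZ mc t theta0 k x b0 nDV).
    rewrite -(TnDr mc t theta0 k x nDh (nnmeas_scale b0 nDV)).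
    apply: (le_Tn mc per H k Ax (nnmeas_scale a0 nDe)).
      exact: (nnmeas_add nDh (nnmeas_scale b0 nDV)).
    move=> y Ay; rewrite -!DnZ// -DnDr//; exact: le_Dn.
  have h2 : (a * (lam * eta x))%:E <=
      a%:E * Tn k (Dn 1 (EFin \o eta)) x + (a * (ce * C * alpha ^+ k * V x))%:E.
    rewrite [X in _ + X]EFinM -ge0_muleDr//; last 2 first.
    + by have [_] := nnmeas_Tn mc H k nDe.
    + by rewrite lee_fin !mulr_ge0 ?exprn_ge0//; exact: ltW.
    by rewrite EFinM; apply: lee_wpmul2l => //; case: (Te x Ax).
  rewrite -mulrA; apply: (le_trans h2).
  apply: (@le_trans _ _ (Tn k (Dn 1 h) x + (b * (cd * ct * V x))%:E +
      (a * (ce * C * alpha ^+ k * V x))%:E)).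
    apply: leeD => //; apply: (le_trans h1); apply: leeD => //.
    by rewrite EFinM; apply: lee_wpmul2l => //; exact: TDV.
  rewrite -addeA -EFinD; apply: leeD => //; rewrite lee_fin addrC; exact: b_le.
Qed.

End block_moments.

(** * Geometric sums *)

Section geometric_sum.
Context (R : realFieldType) (z : R).
Hypothesis z01 : 0 < z < 1.

Let z0 : 0 <= z. Proof. by case/andP: z01 => /ltW. Qed.
Let z1 : z < 1. Proof. by case/andP: z01. Qed.

(** The identity that closes the inductions on the number of blocks: replacing s z^(i+1) by s z^i
    frees exactly z^i. *)
Lemma geometric_limitB : (1 - z)^-1 - (1 - z)^-1 * z = 1.
Proof. by rewrite -{1}[(1 - z)^-1]mulr1 -mulrBr mulVf// subr_eq0 gt_eqF. Qed.

Lemma geometric_sum_le K : \sum_(k < K) z ^+ k <= (1 - z)^-1.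
Proof.
have -> : \sum_(k < K) z ^+ k = (1 - z)^-1 * (1 - z ^+ K).
  rewrite -[X in _ * X]opprB subrX1 -mulNr opprB mulrA mulVf ?mul1r//.
  by rewrite subr_eq0 gt_eqF.
apply: ler_piMr; first by rewrite invr_ge0 subr_ge0 ltW.
by rewrite gerBl exprn_ge0.
Qed.

(** Keeps K z^K bounded, so that an error K^2 z^K is only O(K). *)
Lemma geometric_sum_ge K : K%:R * z ^+ K <= \sum_(k < K) z ^+ k.
Proof.
apply: (@le_trans _ _ (\sum_(k < K) z ^+ K)).
  by rewrite sumr_const card_ord mulr_natl.
by apply: ler_sum => k _; apply: ler_wiXn2l => //; [exact: ltW|exact: ltnW].
Qed.

End geometric_sum.

Ltac nonneg := repeat match goal with
  | |- is_true (0 <= _ + _)%R => apply: addr_ge0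
  | |- is_true (0 <= _ * _)%R => apply: mulr_ge0
  | |- is_true (0 <= _ ^+ _)%R => apply: exprn_ge0
  end; try solve [by [] | exact: ltW].

(** * First moments over K blocks *)

Section block_first_moment.
Context d d' (R : realType) (E : measurableType d) (Om : measurableType d').
Variables (P : R.-pker (option E) ~> Om) (X : nat -> Om -> option E).
Hypothesis mc : absorbed_markov_chain P X.
Variables (t : nat) (A : nat -> set E).
Hypothesis per : periodicity_assumption P X t A.
Variables (V eta : E -> R) (nu : probability E R) (theta0 C alpha : R).
Hypothesis H : assumptionH P X t (A 0%N) V eta nu theta0 C alpha.
Variables (f : E -> R) (M : R).
Hypotheses (mf : measurable_fun setT f) (f0 : forall x, 0 <= f x)
  (fM : forall x, f x <= M) (M0 : 0 <= M).

Local Notation Psg := (Psg P X).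
Local Notation Tn := (block_kernel P X t theta0).
Local Notation Dn := (block_moment1 P X t theta0 f).
Local Notation upper := (upper A V eta).
Local Notation lower := (lower A V eta).
Local Notation lam := (block_mean P X t eta nu theta0 f).
Local Notation one := (fun _ : E => (1 : R)%:E).
Local Notation geo K := (\sum_(k < K) alpha ^+ k).
Let s : R := (1 - alpha)^-1.

Let al0 : 0 < alpha := alpha_gt0 H.
Let al1 : alpha < 1 := alpha_lt1 H.
Let aX0 k : 0 <= alpha ^+ k. Proof. by rewrite exprn_ge0// ltW. Qed.

Let s_gt0 : 0 < s. Proof. by rewrite invr_gt0 subr_gt0. Qed.

Local Open Scope ereal_scope.

Lemma lower_add h1 h2 (a1 b1 a2 b2 : R) : lower h1 a1 b1 -> lower h2 a2 b2 ->
  lower (fun x => h1 x + h2 x) (a1 + a2)%R (b1 + b2)%R.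
Proof.
move=> u1 u2 x Ax; rewrite !mulrDl !EFinD addeACA.
exact: leeD (u1 x Ax) (u2 x Ax).
Qed.

Lemma nnmeas_one : nnmeas one.
Proof. exact: nnmeas_cst. Qed.

Lemma Tn0 h x : nnmeas h -> Tn 0 h x = h x.
Proof. by move=> nh; rewrite /block_kernel mul0n expr0 invr1 (Psg0 mc)// mul1e. Qed.

(** (H) for the constant 1, which is bounded by V on A_0 and has nu-integral 1. *)
Lemma Tn_one j : upper (Tn j one) 1%R (C * alpha ^+ j)%R /\
  lower (Tn j one) 1%R (C * alpha ^+ j)%R.
Proof.
have oneV y : A 0%N y -> one y <= (1 * V y)%:E.
  by move=> Ay; rewrite lee_fin mul1r (H_V_ge1 H).
have I1 : \int[nu]_x (one x) = 1.
  rewrite (@integral_cst _ _ _ nu _ measurableT 1) mul1e.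
  exact: probability_setT.
split=> x Ax; have [h1 h2] := @Tn_cvg _ _ _ _ _ _ _ mc _ _ per _ _ _ _ _ _ H j
  1%R _ x Ax nnmeas_one ltr01 oneV; move: h1 h2; rewrite I1 mule1 mul1r.
- by move=> + _; rewrite mul1r EFinD.
- by move=> _; rewrite mul1r.
Qed.

Let nT j : nnmeas (Tn j one). Proof. exact: (nnmeas_Tn mc H j nnmeas_one). Qed.

Let nD h k : nnmeas h -> nnmeas (Dn k h).
Proof. exact: (nnmeas_Dn mc H mf f0 k). Qed.

Let lam0 : (0 <= lam)%R. Proof. exact: (lam_ge0 mc per H mf f0). Qed.

(* The induction on K runs over all i and j at once: peeling off the last block
   turns T^i into T^(i+1), so that the errors alpha^i are summed. *)
Lemma Dn_upper : exists2 c : R, (0 < c)%R & forall K i j,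
  upper (Dn K (Tn i (Dn 1 (Tn j one)))) (K%:R * lam ^+ 2)%R
    (c * (geo K + s * alpha ^+ i + K%:R * alpha ^+ j))%R.
Proof.
have [c c0 rule] := block_rule mc per H mf f0 fM M0.
have C0 := H_C H.
(* Two uses of [block_rule] leave the error c lam alpha^K + c^2 alpha^i + c^2 C alpha^j; this
   constant dominates all three coefficients. *)
exists (c * lam + c ^+ 2 * (1 + C))%R.
  by rewrite ltr_wpDl ?mulr_gt0 ?exprn_gt0 ?mulr_ge0 ?ltr_wpDr// ltW.
elim=> [|K ih] i j x Ax.
  rewrite Dn0 big_ord0 lee_fin add0r !mul0r add0r addr0.
  rewrite !mulr_ge0 ?(V_ge0 H)//; last exact: ltW.
  by rewrite addr_ge0// mulr_ge0 ?exprn_ge0 ?addr_ge0// ltW.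
have nDj := nD 1 (nT j).
have nTD : nnmeas (Tn i (Dn 1 (Tn j one))) by exact: (nnmeas_Tn mc H).
rewrite -(addn1 K) (Dn_add mc H mf f0)// addn1.
rewrite [X in X + _ <= _](_ : _ = Dn K (Tn i.+1 (Dn 1 (Tn j one))) x); last first.
  by congr (Dn K _ x); apply/funext => y; rewrite -(TnD mc H)// add1n.
have u1 := ih i.+1 j x Ax.
have u2 : upper (Tn K (Dn 1 (Tn i (Dn 1 (Tn j one))))) (lam * lam)%R
    (c * (lam * alpha ^+ K + c * (1 * alpha ^+ i + C * alpha ^+ j)))%R.
  have [h1 _] := rule i _ 1%R _ ler01 (mulr_ge0 C0 (aX0 j)) (nT j).
  have {}h1 := h1 (Tn_one j).1; rewrite mul1r in h1.
  have b0 : (0 <= c * (1 * alpha ^+ i + C * alpha ^+ j))%R.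
    by apply: mulr_ge0; [exact: ltW|rewrite addr_ge0// mulr_ge0].
  have [h2 _] := rule K _ lam _ lam0 b0 nTD.
  exact: h2.
apply: le_trans (leeD u1 (u2 x Ax)) _.
rewrite -EFinD lee_fin big_ord_recr/= (exprS alpha i) -natr1.
set g := (\sum_(_ < _) _)%R; set ai := (alpha ^+ i)%R; set aj := (alpha ^+ j)%R.
set aK := (alpha ^+ K)%R; set l := lam.
have ai0 : (0 <= ai)%R := aX0 i. have aj0 : (0 <= aj)%R := aX0 j.
have aK0 : (0 <= aK)%R := aX0 K.
rewrite -subr_ge0.
rewrite [X in (0 <= X)%R](_ : _ =
  ((c * l + c ^+ 2 * (1 + C)) * (s - s * alpha) * ai - c ^+ 2 * ai +
   c ^+ 2 * (1 + C) * aK + c * l * aj + c ^+ 2 * aj) * V x)%R; last by ring.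
have -> : (s - s * alpha = 1)%R by exact: (geometric_limitB (H_alpha H)).
apply: mulr_ge0; last exact: (V_ge0 H).
have l0 : (0 <= l)%R := lam0.
have -> : ((c * l + c ^+ 2 * (1 + C)) * 1 * ai - c ^+ 2 * ai +
   c ^+ 2 * (1 + C) * aK + c * l * aj + c ^+ 2 * aj =
   c * l * ai + c ^+ 2 * C * ai + c ^+ 2 * (1 + C) * aK + c * l * aj + c ^+ 2 * aj)%R.
  by ring.
have c0' := ltW c0.
by nonneg.
Qed.

(** Each peeled block yields lam eta with error alpha^K + C alpha^j and turns j into j+1. The total
    error is bounded in K. *)
Lemma Dn_lower : exists2 c : R, (0 < c)%R & forall K j,
  lower (Dn K (Tn j one)) (K%:R * lam)%R (c * (geo K + s * alpha ^+ j))%R.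
Proof.
have [c c0 rule] := block_rule mc per H mf f0 fM M0.
have C0 := H_C H; have c0' := ltW c0.
exists (c * (1 + C))%R; first by rewrite mulr_gt0// ltr_wpDr.
elim=> [|K ih] j x Ax.
  rewrite Dn0 add0e big_ord0 !mul0r lee_fin.
  have V0 := V_ge0 H x; have s0 := ltW s_gt0; nonneg.
rewrite -(addn1 K) (Dn_add mc H mf f0)// addn1.
rewrite [X in X + _ + _](_ : _ = Dn K (Tn j.+1 one) x); last first.
  congr (Dn K _ x); apply/funext => y.
  by rewrite -(TnD mc H _ _ _ nnmeas_one) add1n.
have u2 : lower (Tn K (Dn 1 (Tn j one))) (1 * lam)%R
    (c * (1 * alpha ^+ K + C * alpha ^+ j))%R.
  have [_ h1] := rule K _ 1%R _ ler01 (mulr_ge0 C0 (aX0 j)) (nT j).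
  by apply: h1; case: (Tn_one j).
have := lower_add (ih j.+1) u2 Ax; rewrite -mulrDl natr1 => /le_trans; apply.
rewrite leeD2l// lee_fin ler_wpM2r ?(V_ge0 H)// big_ord_recr/= (exprS alpha j).
set g := (\sum_(_ < _) _)%R; set aj := (alpha ^+ j)%R; set aK := (alpha ^+ K)%R.
have aj0 : (0 <= aj)%R := aX0 j. have aK0 : (0 <= aK)%R := aX0 K.
rewrite -subr_ge0.
rewrite [X in (0 <= X)%R](_ : _ = c * (1 + C) * (s - s * alpha) * aj -
  c * C * aj + c * C * aK)%R; last by ring.
have -> : (s - s * alpha = 1)%R by exact: (geometric_limitB (H_alpha H)).
have -> : (c * (1 + C) * 1 * aj - c * C * aj + c * C * aK = c * aj + c * C * aK)%R.
  by ring.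
by nonneg.
Qed.

End block_first_moment.

(** * Second moments over K blocks and the cancellation of the order K^2 *)

Section block_second_moment.
Context d d' (R : realType) (E : measurableType d) (Om : measurableType d').
Variables (P : R.-pker (option E) ~> Om) (X : nat -> Om -> option E).
Hypothesis mc : absorbed_markov_chain P X.
Variables (t : nat) (A : nat -> set E).
Hypothesis per : periodicity_assumption P X t A.
Variables (V eta : E -> R) (nu : probability E R) (theta0 C alpha : R).
Hypothesis H : assumptionH P X t (A 0%N) V eta nu theta0 C alpha.
Variables (f : E -> R) (M : R).
Hypotheses (mf : measurable_fun setT f) (f0 : forall x, 0 <= f x)
  (fM : forall x, f x <= M) (M0 : 0 <= M).

Local Notation Psg := (Psg P X).
Local Notation Tn := (block_kernel P X t theta0).
Local Notation Dn := (block_moment1 P X t theta0 f).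
Local Notation Un := (block_moment2 P X t theta0 f).
Local Notation upper := (upper A V eta).
Local Notation lam := (block_mean P X t eta nu theta0 f).
Local Notation one := (fun _ : E => (1 : R)%:E).
Let s : R := (1 - alpha)^-1.

Let al0 : 0 < alpha := alpha_gt0 H.
Let al1 : alpha < 1 := alpha_lt1 H.
Let aX0 k : 0 <= alpha ^+ k. Proof. by rewrite exprn_ge0// ltW. Qed.

Let s_gt0 : 0 < s. Proof. by rewrite invr_gt0 subr_gt0. Qed.

Local Open Scope ereal_scope.

Let nT j : nnmeas (Tn j one). Proof. exact: (nnmeas_Tn mc H j (nnmeas_one R E)). Qed.

Let nD h k : nnmeas h -> nnmeas (Dn k h).
Proof. exact: (nnmeas_Dn mc H mf f0 k). Qed.

Let nU h k : nnmeas h -> nnmeas (Un k h).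
Proof. exact: (nnmeas_Un mc H mf k). Qed.

Let lam0 : (0 <= lam)%R. Proof. exact: (lam_ge0 mc per H mf f0). Qed.

(** Peeling off a block adds 2 D_K F T^j 1, with main part 2 K lam^2 eta, and T^K U_1 T^j 1 = O(V).
    Since K^2 + 2K <= (K+1)^2, the main part stays below K^2 lam^2 eta. *)
Lemma Un_upper : exists2 c : R, (0 < c)%R & forall K j,
  upper (Un K (Tn j one)) (K%:R ^+ 2 * lam ^+ 2)%R
    (c * (K%:R + K%:R * alpha ^+ j * s))%R.
Proof.
have [cd cd0 DU] := Dn_upper mc per H mf f0 fM M0.
have [ct ct0 TV] := Tn_V mc per H.
have nV := nnmeas_V per H; have n1 := nnmeas_one R E.
set G := (((1 * t)%:R * M) ^+ 2)%R.
have G0 : (0 <= G)%R by exact: sqr_ge0.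
have s0 := ltW s_gt0.
(* In the induction step the increment of K pays for [4 * cd * s + G * ct], and the freed K alpha^j
   pays for the error 2 [cd] K alpha^j of the cross term. *)
exists (4 * cd * s + 2 * cd + G * ct)%R.
  by rewrite ltr_wpDr ?mulr_ge0 ?addr_gt0 ?mulr_gt0// ltW.
elim=> [|K ih] j x Ax.
  rewrite Un0 lee_fin expr0n !mul0r add0r.
  by rewrite addr0 mulr0 mul0r.
rewrite -(addn1 K) (Un_add mc H mf f0)// addn1.
rewrite [X in X + _ + _ <= _](_ : _ = Un K (Tn j.+1 one) x); last first.
  by congr (Un K _ x); apply/funext => y; rewrite -(TnD mc H _ _ _ n1) add1n.
(* Inserting T^0 brings the cross term into the form of [Dn_upper] with i = 0. *)
rewrite [X in _ + _ * X + _ <= _](_ : _ = Dn K (Tn 0 (Dn 1 (Tn j one))) x); last first.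
  by congr (Dn K _ x); apply/funext => y; rewrite (Tn0 mc)//; exact: nD.
have u3 : Tn K (Un 1 (Tn j one)) x <= (G * (ct * V x))%:E.
  apply: (@le_trans _ _ (Tn K (fun y => G%:E * Tn 1 (Tn j one) y) x)).
    apply: (le_Tn mc per H) => //; first exact: nU.
      by apply: nnmeas_scale => //; exact: (nnmeas_Tn mc H).
    by move=> y _; exact: (Un_le mc H).
  have nTT : nnmeas (Tn 1 (Tn j one)) by exact: (nnmeas_Tn mc H).
  rewrite (TnZ mc t theta0 K x G0 nTT) [X in _ <= X]EFinM; apply: lee_wpmul2l => //.
  rewrite -(TnD mc H)//.
  rewrite [X in X <= _](_ : _ = Tn (K + 1 + j) one x); last first.
    by rewrite (TnD mc H (K + 1) j x n1).
  apply: le_trans (TV (K + 1 + j)%N x Ax).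
  apply: (le_Tn mc per H) => // y Ay.
  by rewrite lee_fin (H_V_ge1 H).
have u2 : 2%:E * Dn K (Tn 0 (Dn 1 (Tn j one))) x <=
   (2 * (K%:R * lam ^+ 2 * eta x + cd * (s + s + K%:R * alpha ^+ j) * V x))%:E.
  rewrite EFinM; apply: lee_wpmul2l => //; apply: le_trans (DU K 0%N j x Ax) _.
  rewrite lee_fin expr0 mulr1 lerD2l; apply: ler_wpM2r; first exact: (V_ge0 H).
  apply: ler_wpM2l; first exact: ltW.
  by rewrite !lerD2r; exact: (geometric_sum_le (H_alpha H)).
apply: le_trans (leeD (leeD (ih j.+1 x Ax) u2) u3) _.
rewrite -!EFinD lee_fin (exprS alpha j) -natr1.
set aj := (alpha ^+ j)%R; set l := lam; set v := V x.
have aj0 : (0 <= aj)%R := aX0 j.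
rewrite -subr_ge0.
rewrite [X in (0 <= X)%R](_ : _ = l ^+ 2 * eta x +
  ((4 * cd * s + 2 * cd + G * ct) * (s * aj) + 2 * cd +
   (4 * cd * s + 2 * cd + G * ct) * K%:R * aj * (s - s * alpha)
    - 2 * cd * K%:R * aj) * v)%R; last by ring.
have -> : (s - s * alpha = 1)%R by exact: (geometric_limitB (H_alpha H)).
rewrite [X in (0 <= X)%R](_ : _ = ((4 * cd * s + 2 * cd + G * ct) * (s * aj) +
    2 * cd + (4 * cd * s + G * ct) * K%:R * aj) * v + l ^+ 2 * eta x)%R; last by ring.
have v0 : (0 <= v)%R := V_ge0 H x; have e0 := eta_ge0 H x.
nonneg.
Qed.

(** Here the K^2 lam^2 eta terms cancel. The parameters [a] and [b] leave room for the steps made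
    before A_0 is entered, whose contribution is O(K V). *)
Lemma block_moment_bound (a b : R) : (0 <= a)%R -> (0 <= b)%R ->
  exists2 c : R, (0 < c)%R & forall K x, (0 < K)%N -> A 0%N x ->
  (a + K%:R ^+ 2 * lam ^+ 2)%:E * Tn K one x + b%:E * Dn K one x + Un K one x <=
  (2 * K%:R * lam)%:E * Dn K one x + (c * K%:R)%:E * (V x)%:E.
Proof.
move=> a0 b0.
have [cl cl0 DL] := Dn_lower mc per H mf f0 fM M0.
have [cu cu0 UU] := Un_upper.
have [ct ct0 TV] := Tn_V mc per H.
have nV := nnmeas_V per H; have n1 := nnmeas_one R E.
have s0 := ltW s_gt0; have C0 := H_C H.
set tM := (t%:R * M)%R; have tM0 : (0 <= tM)%R by rewrite mulr_ge0.
(* The summands stem, in order, from a T^K 1, b D_K 1, the error of U_K 1, the error K^2 alpha^K of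
   T^K 1, and the error of D_K 1 multiplied by 2 K lam. *)
exists (a * ct + b * tM * ct + cu * (1 + s) + lam ^+ 2 * C * s + 4 * lam * cl * s)%R.
  have : (0 < cu * (1 + s))%R by rewrite mulr_gt0// ltr_pwDl.
  have : (0 <= a * ct)%R by rewrite mulr_ge0// ltW.
  have : (0 <= b * tM * ct)%R by rewrite !mulr_ge0// ltW.
  have : (0 <= lam ^+ 2 * C * s)%R by nonneg.
  have : (0 <= 4 * lam * cl * s)%R by nonneg.
  by lra.
move=> K x K0 Ax.
have ctV : Tn K one x <= (ct * V x)%:E.
  apply: le_trans (TV K x Ax); apply: (le_Tn mc per H) => // y Ay.
  by rewrite lee_fin (H_V_ge1 H).
have hD : Dn K one x <= (K%:R * tM * (ct * V x))%:E.
  apply: le_trans (Dn_le mc H mf f0 fM M0 K x n1) _.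
  rewrite natrM -mulrA -/tM [X in _ <= X]EFinM; apply: lee_wpmul2l => //.
  by rewrite lee_fin mulr_ge0.
have hT : Tn K one x <= (1 * eta x + C * alpha ^+ K * V x)%:E.
  by have [h _] := Tn_one mc per H K; exact: h.
have hU := UU K 0%N x Ax.
have hL := DL K 0%N x Ax.
rewrite [Dn K _](_ : _ = Dn K one) in hL; last first.
  by congr (Dn K _); apply/funext => y; rewrite (Tn0 mc).
rewrite [Un K _](_ : _ = Un K one) in hU; last first.
  by congr (Un K _); apply/funext => y; rewrite (Tn0 mc).
have [_ T0] := nnmeas_Tn mc H K n1.
have [_ D0] := nD K n1.
have [_ U0] := nU K n1.
(* At a point of A_0 all three quantities are finite, so the rest is real arithmetic. *)
have fin (z : \bar R) (r : R) : 0 <= z -> z <= r%:E -> exists q : R, z = q%:E.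
  by case: z => [q| |]//; exists q.
have [ta Ta] := fin _ _ (T0 x) ctV.
have [de De] := fin _ _ (D0 x) hD.
have [up Up] := fin _ _ (U0 x) hU.
move: (T0 x) (D0 x) ctV hD hT hU hL; rewrite Ta De Up.
rewrite -!EFinM -!EFinD !lee_fin expr0 => ta0 de0 h1 h2 h3 h4 h5.
have k1 : (1 <= K%:R :> R)%R by rewrite ler1n.
have g1 := geometric_sum_le (H_alpha H) K; have g2 := geometric_sum_ge (H_alpha H) K.
have V0 := V_ge0 H x; have e0 := eta_ge0 H x.
move: g1 g2 h3 h5; set g := (\sum_(_ < _) _)%R; set aK := (alpha ^+ K)%R.
rewrite -/s => g1 g2 h3 h5.
set k := (K%:R : R) in k1 g1 g2 h1 h2 h3 h4 h5 *; set l := lam in h4 h5 *.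
set v := V x in V0 h1 h2 h3 h4 h5 *; set e := eta x in e0 h3 h4 h5 *.
have k0 : (0 <= k)%R by exact: le_trans k1.
have q1 : (a * ta <= a * (ct * v))%R by exact: ler_wpM2l.
have q1' : (a * (ct * v) <= k * (a * (ct * v)))%R.
  by rewrite ler_peMl// !mulr_ge0// ltW.
have q2 : (b * de <= b * (k * tM * (ct * v)))%R by exact: ler_wpM2l.
have q3 : (k ^+ 2 * l ^+ 2 * ta <= k ^+ 2 * l ^+ 2 * (1 * e + C * aK * v))%R.
  by apply: ler_wpM2l => //; nonneg.
have q4 : (k * (l ^+ 2 * C * v) * (k * aK) <= k * (l ^+ 2 * C * v) * s)%R.
  by apply: ler_wpM2l; [nonneg|exact: le_trans g1].
have q5 : (2 * k * l * (k * l * e) <= 2 * k * l * (de + cl * (g + s * 1) * v))%R.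
  by apply: ler_wpM2l => //; nonneg.
have q6 : (2 * k * l * (cl * (g + s * 1) * v) <= 2 * k * l * (cl * (s + s) * v))%R.
  apply: ler_wpM2l; first by nonneg.
  by apply: ler_wpM2r => //; apply: ler_wpM2l; [exact: ltW|lra].
have q3' : (k ^+ 2 * l ^+ 2 * (C * aK * v) = k * (l ^+ 2 * C * v) * (k * aK))%R by ring.
nra.
Qed.

(** The path is cut when it enters A_0, after t - i steps (a full period if i = 0). These steps
    contribute at most tM to S, hence the choices a = (tM)^2 and b = 2 tM in [block_moment_bound],
    which is then integrated along them. *)
Lemma moment_bound : exists2 c : R, (0 < c)%R &
  forall K i x, (0 < K)%N -> (i < t)%N -> A i x ->
  moment2 P X f (t - i + K * t) one x +
    (K%:R ^+ 2 * lam ^+ 2)%:E * Psg (t - i + K * t) one x <=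
  (2 * K%:R * lam)%:E * moment1 P X f (t - i + K * t) one x +
    (c * K%:R * theta0 ^+ (K * t))%:E * Psg (t - i) (EFin \o V) x.
Proof.
set tM := (t%:R * M)%R; have tM0 : (0 <= tM)%R by rewrite mulr_ge0.
have b0 : (0 <= 2 * tM)%R by rewrite mulr_ge0.
have [c c0 hc] := block_moment_bound (sqr_ge0 tM) b0.
exists c => // K i x K0 it Ax.
have nV := nnmeas_V per H; have n1 := nnmeas_one R E.
set m := (t - i)%N; set n := (K * t)%N; set th := (theta0 ^+ n)%R.
have th0 : (0 < th)%R by rewrite exprn_gt0// (theta0_gt0 H).
have nP := nnmeas_Psg mc n n1.
have nM1 := nnmeas_M1 mc mf f0 n n1; have nM2 := nnmeas_M2 mc mf n n1.
have mt : (m%:R * M <= tM)%R by rewrite ler_wpM2r// ler_nat leq_subr.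
have mM0 : (0 <= m%:R * M)%R by rewrite mulr_ge0.
have PE : Psg n one = fun y => th%:E * Tn K one y.
  apply/funext => y; rewrite /block_kernel -/n muleA -EFinM mulfV ?mul1e//.
  by rewrite gt_eqF.
have M1E : moment1 P X f n one = fun y => th%:E * Dn K one y.
  apply/funext => y; rewrite /block_moment1 -/n muleA -EFinM mulfV ?mul1e//.
  by rewrite gt_eqF.
have M2E : moment2 P X f n one = fun y => th%:E * Un K one y.
  apply/funext => y; rewrite /block_moment2 -/n muleA -EFinM mulfV ?mul1e//.
  by rewrite gt_eqF.
rewrite (M2D mc mf f0 m n n1) (M1D mc mf f0 m n n1) (PsgD mc m n n1).
set p := Psg m (Psg n one) x; set q := Psg m (moment1 P X f n one) x.
set r := Psg m (moment2 P X f n one) x; set v := Psg m _ x.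
have p0 : 0 <= p by exact: (nnmeas_Psg mc m nP).2.
have q0 : 0 <= q by exact: (nnmeas_Psg mc m nM1).2.
have r0 : 0 <= r by exact: (nnmeas_Psg mc m nM2).2.
have h2 : moment2 P X f m (Psg n one) x <= (tM ^+ 2)%:E * p.
  apply: le_trans (M2_le mc mf f0 fM M0 m x nP) _.
  have sq : ((m%:R * M) ^+ 2 <= tM ^+ 2)%R by rewrite lerXn2r ?nnegrE.
  apply: lee_wpmul2r; first exact: p0.
  by rewrite lee_fin.
have h1 : moment1 P X f m (moment1 P X f n one) x <= tM%:E * q.
  apply: le_trans (M1_le mc mf f0 fM M0 m x nM1) _.
  apply: lee_wpmul2r; first exact: q0.
  by rewrite lee_fin.
have key : (tM ^+ 2 + K%:R ^+ 2 * lam ^+ 2)%:E * p + (2 * tM)%:E * q + r <=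
    (2 * K%:R * lam)%:E * q + (c * K%:R * th)%:E * v.
  have nT1 := nT 0; have nTK : nnmeas (Tn K one) by exact: (nnmeas_Tn mc H).
  have nDK := nD K n1; have nUK := nU K n1.
  rewrite /p /q /r PE M1E M2E !(PsgZ mc m x (ltW th0))//.
  set a := (tM ^+ 2 + _)%R; set l := (2 * _ * lam)%R.
  have a0 : (0 <= a)%R by rewrite /a; nonneg.
  have l0 : (0 <= l)%R by rewrite /l; nonneg.
  have cK0 : (0 <= c * K%:R)%R by nonneg.
  have na := nnmeas_scale a0 nTK; have nb := nnmeas_scale b0 nDK.
  have nl := nnmeas_scale l0 nDK; have nc := nnmeas_scale cK0 nV.
  have nab := nnmeas_add na nb.
  have : Psg m (fun y => a%:E * Tn K one y + (2 * tM)%:E * Dn K one y + Un K one y) x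
      <= Psg m (fun y => l%:E * Dn K one y + (c * K%:R)%:E * (EFin \o V) y) x.
    rewrite -!(@ev1 _ _ _ _ _ P X m).
    apply: (@le_ev_class _ _ _ _ _ _ _ mc _ _ per m i 0%N) => //.
    + by rewrite /m subnKC ?modnn// ltnW.
    + exact: (nnmeas_add nab nUK).
    + exact: (nnmeas_add nl nc).
    + by move=> y Ay; exact: hc.
  rewrite (PsgM1D mc m x nab nUK) (PsgM1D mc m x na nb) (PsgM1D mc m x nl nc).
  rewrite (PsgZ mc m x a0 nTK) (PsgZ mc m x b0 nDK) (PsgZ mc m x l0 nDK).
  rewrite (PsgZ mc m x cK0 nV) -/v.
  have [_ z1] := nnmeas_Psg mc m nTK; have [_ z2] := nnmeas_Psg mc m nDK.
  have [_ z3] := nnmeas_Psg mc m nUK; have [_ z4] := nnmeas_Psg mc m nV.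
  move: (z1 x) (z2 x) (z3 x) (z4 x); rewrite -/v.
  move: (Psg m (Tn K one) x) (Psg m (Dn K one) x) (Psg m (Un K one) x) v.
  move=> u1 u2 u3 u4 u10 u20 u30 u40 hle.
  have := @lee_wpmul2l _ th%:E (ltW th0) _ _ hle.
  rewrite !ge0_muleDr ?adde_ge0 ?mule_ge0//.
  by rewrite !muleA -!EFinM !(mulrC th).
apply: (@le_trans _ _ ((tM ^+ 2 + K%:R ^+ 2 * lam ^+ 2)%:E * p + (2 * tM)%:E * q + r)).
  rewrite (EFinD (tM ^+ 2)) ge0_muleDl ?lee_fin ?sqr_ge0//; last by nonneg.
  rewrite (addeAC _ r) (addeAC _ (2%:E * _)); apply: leeD2r.
  apply: leeD; first exact: leeD2r.
  by rewrite (EFinM 2) -muleA; exact: lee_wpmul2l.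
apply: (le_trans key); apply: leeD2r; apply: lee_wpmul2l.
  by rewrite lee_fin; nonneg.
(* On the right, the first moment of the entry steps is nonnegative and is dropped. *)
by apply: leeDr; exact: (nnmeas_M1 mc mf f0 m nP).2.
Qed.

End block_second_moment.

(** * Chebyshev's inequality for the chain killed at the cemetery *)

(** [N] consists of t - i entry steps, K full periods and a remainder below t; entry and remainder
    together account for the [2 * t]. *)
Lemma block_decomposition (t i T N : nat) : (0 < t)%N -> (i < t)%N ->
  (2 * t + T <= N)%N -> exists K, let n := (t - i + K * t)%N in
  [/\ (0 < K)%N, (n <= N)%N, (N.+1 - n <= t)%N & (T <= N)%N] /\
  [/\ (K * t <= N.+1)%N, (N.+1 - K * t <= 2 * t)%N, (K <= N.+1)%N &
    (N <= K * t + 2 * t)%N].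
Proof.
move=> t0 it NN; exists ((N - (t - i)) %/ t)%N.
have K0 : (0 < (N - (t - i)) %/ t)%N by rewrite divn_gt0//; lia.
have KtN := leq_divM (N - (t - i)) t.
have NK := ltn_ceil (N - (t - i)) t0; rewrite mulSn in NK.
have KKt : ((N - (t - i)) %/ t <= (N - (t - i)) %/ t * t)%N by rewrite leq_pmulr.
move: K0 KtN NK KKt; set K := ((N - (t - i)) %/ t)%N; set m := (K * t)%N.
by move=> *; split; split; lia.
Qed.

Section deviation.
Context d d' (R : realType) (E : measurableType d) (Om : measurableType d').
Variables (P : R.-pker (option E) ~> Om) (X : nat -> Om -> option E).
Hypothesis mc : absorbed_markov_chain P X.
Variables (t : nat) (A : nat -> set E).
Hypothesis per : periodicity_assumption P X t A.
Variables (V eta : E -> R) (nu : probability E R) (theta0 C alpha : R).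
Hypothesis H : assumptionH P X t (A 0%N) V eta nu theta0 C alpha.
Variables (f : E -> R) (M : R).
Hypotheses (mf : measurable_fun setT f) (f0 : forall x, 0 <= f x)
  (fM : forall x, f x <= M) (M0 : 0 <= M).

Local Notation Psg := (Psg P X).
Local Notation upper := (upper A V eta).
Local Notation lower := (lower A V eta).
Local Notation lam := (block_mean P X t eta nu theta0 f).
Local Notation one := (fun _ : E => (1 : R)%:E).
Local Notation S := (partial_sum X f).

Local Open Scope ereal_scope.

Local Notation ev := (killed_expectation P X).

Lemma ev_scalel n (Phi : Om -> R) (k : R) h x :
  ev n (fun w => k * Phi w)%R h x = ev n Phi (fun y => k%:E * h y) x.
Proof.
apply: eq_integral => w _; case: (X n w) => [y|]/=; last by rewrite !mule0.
by rewrite EFinM -muleA muleCA.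
Qed.

(** The square is expanded with 2 a S moved to the other side. Cancelling its expectation is
    legitimate because [f] is bounded and the first moment is therefore finite. *)
Lemma centered_moment n (a B : R) x : (0 <= a)%R ->
  moment2 P X f n one x + (a ^+ 2)%:E * Psg n one x <=
    (2 * a)%:E * moment1 P X f n one x + B%:E ->
  ev n (fun w => (S n w - a) ^+ 2)%R one x <= B%:E.
Proof.
move=> a0 h; have [m1 h1] := nnmeas_one R E.
have mS := measurable_partial_sum mc mf n.
have S0 := partial_sum_ge0 X f0 n.
have aa0 : (0 <= 2 * a)%R by rewrite mulr_ge0.
have sq : (fun w : Om => (S n w - a) ^+ 2 + (2 * a) * S n w)%R =
    (fun w => S n w ^+ 2 + (a ^+ 2) * 1)%R.
  by apply/funext => w; ring.
have e1 : ev n (fun w => (S n w - a) ^+ 2 + (2 * a) * S n w)%R one x =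
    ev n (fun w => (S n w - a) ^+ 2)%R one x + (2 * a)%:E * moment1 P X f n one x.
  rewrite (ev_addl mc)//.
  - congr (_ + _); rewrite ev_scalel.
    exact: (M1Z mc mf f0 n x aa0 (nnmeas_one R E)).
  - by apply: measurable_funX; apply: measurable_funB.
  - by move=> w; exact: sqr_ge0.
  - exact: measurable_funM.
  - by move=> w; rewrite mulr_ge0.
have e2 : ev n (fun w => S n w ^+ 2 + (a ^+ 2) * 1)%R one x =
    moment2 P X f n one x + (a ^+ 2)%:E * Psg n one x.
  rewrite (ev_addl mc)//.
  - congr (_ + _); rewrite ev_scalel ev1.
    exact: (PsgZ mc n x (sqr_ge0 a) (nnmeas_one R E)).
  - exact: (measurable_partial_sum2 mc mf).
  - by move=> w; exact: sqr_ge0.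
  - by move=> w; rewrite mulr1 sqr_ge0.
rewrite sq e2 in e1; move: h; rewrite e1 addeC leeD2lE//.
rewrite ge0_fin_numE; last first.
  rewrite mule_ge0 ?lee_fin//; exact: (nnmeas_M1 mc mf f0 n (nnmeas_one R E)).2.
rewrite lte_mul_pinfty//.
apply: le_lt_trans (M1_le mc mf f0 fM M0 n x (nnmeas_one R E)) _.
rewrite lte_mul_pinfty ?lee_fin// ?mulr_ge0//.
exact: le_lt_trans (Psg_cst1_le1 mc n x) (ltry _).
Qed.

Lemma alive_le m n : (m <= n)%N -> alive R X n `<=` alive R X m.
Proof.
move=> mn w; rewrite !aliveE => h k km; apply: h; exact: leq_trans km mn.
Qed.

Lemma ev_markov n (Phi : Om -> R) (B : set Om) (r : R) x :
  measurable_fun setT Phi -> (forall w, (0 <= Phi w)%R) -> measurable B ->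
  (0 <= r)%R -> B `<=` alive R X n -> (forall w, B w -> (r <= Phi w)%R) ->
  r%:E * P (Some x) B <= ev n Phi one x.
Proof.
move=> mPhi Phi0 mB r0 Bn Br; have mal := measurable_alive mc n.
rewrite -(setIidl Bn) -integral_indic// -ge0_integralZl_EFin//; last first.
  by apply/measurable_EFinP; exact: measurable_indic.
apply: ge0_le_integral => //.
- by move=> w _; rewrite mule_ge0.
- by apply: measurable_funeM; apply/measurable_EFinP; exact: measurable_indic.
- apply: (@measurable_funS _ _ _ _ setT) => //.
  apply: emeasurable_funM; first exact/measurable_EFinP.
  by apply: (measurable_oapp_chain mc).
- move=> w; rewrite aliveE => /(_ n (leqnn n)).
  case: (X n w) => [y|]//= _; rewrite mule1 -EFinM lee_fin indicE.
  case: (boolP (w \in B)) => [|_]; last by rewrite mulr0.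
  by rewrite in_setE mulr1; exact: Br.
Qed.

Definition deviation (l eps : R) N : set Om :=
  [set w | (eps < `|time_average X f N w - l|)%R].

Lemma measurable_time_average N : measurable_fun setT (time_average X f N).
Proof.
apply: measurable_funM => //; exact: (measurable_partial_sum mc mf).
Qed.

Lemma measurable_deviation l eps N : measurable (deviation l eps N).
Proof.
rewrite (_ : deviation l eps N = setT `&`
    (fun w => `|time_average X f N w - l|)%R @^-1` `]eps, +oo[%classic).
  have mt : measurable_fun setT (fun w => `|time_average X f N w - l|)%R.
    apply: measurableT_comp => //; apply: measurable_funB => //.
    exact: measurable_time_average.
  by apply: mt => //; exact: measurable_itv.
by apply/seteqP; split => w /=; rewrite in_itv/= andbT//; case.
Qed.

Lemma partial_sum_sub n N w : (n <= N)%N ->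
  (`|S N w - S n w| <= (N - n)%:R * M)%R.
Proof.
move=> nN; rewrite -(subnK nN); elim: (N - n)%N => [|k ih].
  by rewrite add0n subrr normr0 subnn mul0r.
rewrite addSn partial_sumS -addrAC subSn ?leq_addl// -natr1 mulrDl mul1r.
apply: le_trans (ler_normD _ _) _; rewrite lerD//.
by rewrite ger0_norm ?oappf_ge0// oappf_le.
Qed.

(** S_(N+1) differs from S_n by at most tM, and (N+1) lam/t from K lam by at most 2 lam. For large N
    a deviation therefore forces |S_n - K lam| >= eps (N+1)/2, to which Chebyshev applies. *)
Lemma deviation_bound (eps : R) : (0 < eps)%R -> exists c : R, exists N0 : nat,
  (0 < c)%R /\ forall N i x, (N0 <= N)%N -> (i < t)%N -> A i x ->
  P (Some x) (deviation (lam / t%:R) eps N `&` alive R X N) <=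
  (c * theta0 ^+ N / N.+1%:R)%:E * Psg (t - i) (EFin \o V) x.
Proof.
move=> eps0; have [c c0 hc] := moment_bound mc per H mf f0 fM M0.
have t0 := period_gt0 per; have th0 := theta0_gt0 H; have th1 := theta0_le1 H.
have lam0 : (0 <= lam)%R := lam_ge0 mc per H mf f0.
set L := (lam / t%:R)%R; have tR : (0 < t%:R :> R)%R by rewrite ltr0n.
have L0 : (0 <= L)%R by rewrite divr_ge0// ltW.
(* Once N + 1 exceeds [D], the boundary terms use up at most half of eps (N+1). *)
set D := (2 * (t%:R * M + 2 * t%:R * L) / eps)%R.
have D0 : (0 <= D)%R by rewrite divr_ge0 ?mulr_ge0 ?addr_ge0 ?mulr_ge0// ltW.
(* 4/eps^2 comes from the squared threshold, and the power of [theta0] from K t >= N - 2t with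
   [theta0] at most 1. *)
exists (4 * c / eps ^+ 2 * theta0 ^- (2 * t))%R.
exists (2 * t + (Num.truncn D).+1)%N; split.
  by rewrite !mulr_gt0 ?invr_gt0 ?exprn_gt0.
move=> N i x NN it Ax.
have [K [[K0 nN Nn TN] [KtN NKt KN NK]]] := block_decomposition t0 it NN.
set n := (t - i + K * t)%N in nN Nn.
set a := (K%:R * lam)%R; have a0 : (0 <= a)%R by rewrite mulr_ge0.
have nV := nnmeas_V per H.
have V0 : 0 <= Psg (t - i) (EFin \o V) x := (nnmeas_Psg mc (t - i) nV).2 x.
set v := Psg (t - i) (EFin \o V) x in V0 *.
have N1 : (0 < N.+1%:R :> R)%R by rewrite ltr0n.
have C0 : (0 < 4 * c / eps ^+ 2 * theta0 ^- (2 * t) * theta0 ^+ N / N.+1%:R)%R.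
  by rewrite !mulr_gt0 ?invr_gt0 ?exprn_gt0.
have : v \is a fin_num \/ v = +oo by case: v V0 => [r| |]; [left|right|].
(* If P_(t-i) V is infinite at [x], the bound is trivial. *)
move=> [vfin|->]; last by rewrite gt0_muley ?lte_fin// leey.
set B := deviation L eps N `&` alive R X N.
have mB : measurable B.
  apply: measurableI; first exact: measurable_deviation.
  exact: (measurable_alive mc).
have mS := measurable_partial_sum mc mf n.
set dl := (eps * N.+1%:R / 2)%R.
have dl0 : (0 < dl)%R by rewrite !mulr_gt0.
have DN : (t%:R * M + 2 * t%:R * L <= dl)%R.
  have D1 : (D < (Num.truncn D).+1%:R)%R by exact: truncnS_gt.
  have D2 : ((Num.truncn D).+1%:R <= N.+1%:R :> R)%R by rewrite ler_nat leqW.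
  have : (D <= N.+1%:R)%R by exact: ltW (lt_le_trans D1 D2).
  by rewrite /D ler_pdivrMr// /dl; lra.
have Bdl w : B w -> (dl ^+ 2 <= (S n w - a) ^+ 2)%R.
  move=> [dev _]; rewrite -(real_normK (num_real (S n w - a)))
    lerXn2r ?nnegrE ?normr_ge0 ?(ltW dl0)//.
  move: dev; rewrite /deviation/= /time_average -/(S N.+1 w).
  have -> : (N.+1%:R^-1 * S N.+1 w - L = (S N.+1 w - N.+1%:R * L) / N.+1%:R)%R.
    by rewrite mulrBl (mulrAC _ L) mulfV ?gt_eqF// mul1r mulrC.
  rewrite normrM normfV (ger0_norm (ltW N1)) ltr_pdivlMr// => dev.
  have h1 := @partial_sum_sub n N.+1 w (leqW nN).
  have h2 : (`|a - N.+1%:R * L| <= 2 * t%:R * L)%R.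
    have -> : (a - N.+1%:R * L = - ((N.+1 - K * t)%:R * L))%R.
      rewrite natrB//.
      rewrite natrM mulrBl; have -> : (K%:R * t%:R * L = a)%R.
        by rewrite /L /a; field; rewrite gt_eqF.
      by ring.
    rewrite normrN ger0_norm ?mulr_ge0// ler_wpM2r//.
    by rewrite -natrM ler_nat.
  have h3 : ((N.+1 - n)%:R * M <= t%:R * M)%R.
    by rewrite ler_wpM2r// ler_nat.
  have e : (S N.+1 w - N.+1%:R * L =
      (S N.+1 w - S n w) + (S n w - a) + (a - N.+1%:R * L))%R by ring.
  have h4 := ler_normD (S N.+1 w - S n w + (S n w - a))%R (a - N.+1%:R * L)%R.
  have h5 := ler_normD (S N.+1 w - S n w)%R (S n w - a)%R.
  rewrite -e in h4; rewrite /dl in DN *; lra.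
have hv := hc K i x K0 it Ax; rewrite -/n -/v in hv.
have var : ev n (fun w => (S n w - a) ^+ 2)%R one x <=
    (c * K%:R * theta0 ^+ (K * t) * fine v)%:E.
  apply: centered_moment => //.
  by rewrite [X in _ <= _ + X]EFinM fineK// /a exprMn (mulrA 2%R).
have mk : (dl ^+ 2)%:E * P (Some x) B <= (c * K%:R * theta0 ^+ (K * t) * fine v)%:E.
  apply: le_trans var; apply: ev_markov => //.
  - by apply: measurable_funX; apply: measurable_funB.
  - by move=> w; exact: sqr_ge0.
  - exact: sqr_ge0.
  - by move=> w [_ aw]; exact: alive_le aw.
have PB1 : P (Some x) B <= 1.
  rewrite -(@prob_kernel _ _ _ _ _ P (Some x)).
  by apply: le_measure; rewrite ?inE.
have PB0 : 0 <= P (Some x) B by [].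
move: mk PB0; rewrite -(fineK vfin).
case: (P (Some x) B) PB1 => [p| |]//= _.
rewrite -!EFinM !lee_fin => mk p0.
have fv0 : (0 <= fine v)%R by exact: fine_ge0.
have KN' : (K%:R <= N.+1%:R :> R)%R by rewrite ler_nat.
have thK : (theta0 ^+ (K * t) <= theta0 ^+ N * theta0 ^- (2 * t))%R.
  rewrite ler_pdivlMr ?exprn_gt0// -exprD; apply: ler_wiXn2l => //; exact: ltW.
have b1 : (c * K%:R * theta0 ^+ (K * t) * fine v <=
    c * N.+1%:R * (theta0 ^+ N * theta0 ^- (2 * t)) * fine v)%R.
  apply: ler_wpM2r => //; apply: ler_pM => //.
  - by rewrite mulr_ge0// ltW.
  - by rewrite exprn_ge0// ltW.
  - by rewrite ler_wpM2l// ltW.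
have dl2 : (0 < dl ^+ 2)%R by rewrite exprn_gt0.
rewrite -(@ler_pM2l _ (dl ^+ 2)%R)//; apply: (le_trans mk); apply: (le_trans b1).
rewrite le_eqVlt; apply/orP; left; apply/eqP; rewrite /dl.
by field; rewrite ?gt_eqF// ?exprn_gt0.
Qed.

End deviation.

Lemma geometric_eventually_le (R : realType) (c z v e : R) :
  0 <= c -> 0 < z < 1 -> 0 <= v -> 0 < e ->
  exists K0, forall K, (K0 <= K)%N -> c * z ^+ K * v <= e.
Proof.
move=> c0 /andP[z0 z1] v0 e0.
have cv0 : 0 < c * v + 1 by rewrite ltr_wpDl// mulr_ge0.
have : (z ^+ n) @[n --> \oo] --> (0 : R) by apply: cvg_expr; rewrite gtr0_norm.
move=> /cvgrPdist_lt /(_ _ (divr_gt0 e0 cv0)) [K0 _ hK]; exists K0 => K /hK /=.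
rewrite sub0r normrN ger0_norm ?exprn_ge0 ?(ltW z0)// ltr_pdivlMr// => h.
apply: ltW; apply: le_lt_trans h.
have zK0 : 0 <= z ^+ K by rewrite exprn_ge0// ltW.
lra.
Qed.

(** * Lower bound for the survival probability *)

Section survival.
Context d d' (R : realType) (E : measurableType d) (Om : measurableType d').
Variables (P : R.-pker (option E) ~> Om) (X : nat -> Om -> option E).
Hypothesis mc : absorbed_markov_chain P X.
Variables (t : nat) (A : nat -> set E).
Hypothesis per : periodicity_assumption P X t A.
Variables (V eta : E -> R) (nu : probability E R) (theta0 C alpha : R).
Hypothesis H : assumptionH P X t (A 0%N) V eta nu theta0 C alpha.
Variable mu : probability E R.

Local Notation Psg := (Psg P X).
Local Notation Tn := (block_kernel P X t theta0).
Local Notation one := (fun _ : E => (1 : R)%:E).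
Local Open Scope ereal_scope.

Lemma measurable_law (B : set Om) : measurable B ->
  measurable_fun setT (fun x => P (Some x) B).
Proof.
move=> mB; apply: (@measurableT_comp _ _ _ _ _ _ (fun v => P v B) _ Some).
  exact: measurable_kernel.
exact: measurable_fun_Some.
Qed.

Lemma Pinit_le1 (B : set Om) : measurable B -> Pinit P mu B <= 1.
Proof.
move=> mB; have -> : 1 = \int[mu]_x cst 1 x :> \bar R.
  rewrite (@integral_cst _ _ _ mu _ measurableT 1) mul1e.
  by apply/esym; exact: probability_setT.
apply: ge0_le_integral => //; first exact: measurable_law.
move=> x _; rewrite -(@prob_kernel _ _ _ _ _ P (Some x)).
by apply: le_measure; rewrite ?inE.
Qed.

Lemma Pinit_ge0 (B : set Om) : 0 <= Pinit P mu B.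
Proof. exact: integral_ge0. Qed.

Lemma Pinit_fin (B : set Om) : measurable B -> Pinit P mu B \is a fin_num.
Proof.
move=> mB; rewrite ge0_fin_numE ?Pinit_ge0//.
exact: le_lt_trans (Pinit_le1 mB) (ltry _).
Qed.

(** The bound eta <= T^K 1 + C alpha^K V on A_0, integrated along the t - i entry steps. *)
Lemma survival_ge_eta K i x : (i < t)%N -> A i x ->
  Psg (t - i) (EFin \o eta) x <=
  (theta0 ^- (K * t))%:E * P (Some x) (alive R X (t - i + K * t)) +
  (C * alpha ^+ K)%:E * Psg (t - i) (EFin \o V) x.
Proof.
move=> it Ax; have nV := nnmeas_V per H; have n1 := nnmeas_one R E.
have th0 := thetaX_ge0 H (K * t).
have nP := nnmeas_Psg mc (K * t) n1.
have nT : nnmeas (Tn K one) by exact: (nnmeas_Tn mc H).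
have b0 : (0 <= C * alpha ^+ K)%R.
  by rewrite mulr_ge0 ?(H_C H)// exprn_ge0// ltW// (alpha_gt0 H).
have nbV := nnmeas_scale b0 nV.
have := @le_ev_class _ _ _ _ _ _ _ mc _ _ per (t - i) i 0%N (fun=> 1%R) (EFin \o eta)
  (fun y => Tn K one y + (C * alpha ^+ K)%:E * (EFin \o V) y) x.
rewrite !(@ev1 _ _ _ _ _ P X) (PsgM1D mc _ _ nT nbV) (PsgZ mc _ _ b0 nV).
rewrite (PsgZ mc _ _ th0 nP) -(PsgD mc _ _ n1) -(Psg_cst1 mc); apply => //.
- by rewrite subnKC ?modnn// ltnW.
- exact: (nnmeas_eta per H).
- exact: nnmeas_add.
- move=> y Ay; have [_ h] := Tn_one mc per H K.
  by have := h y Ay; rewrite mul1r.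
Qed.

(** After integration over A_i the left side is a fixed positive number, and for large K the error
    alpha^K is at most half of it. *)
Lemma survival_lower :
  (exists2 i, (i < t)%N &
     0 < \int[mu]_(x in A i) eta_ P X theta0 eta (t - i) x) ->
  (forall i, (i < t)%N ->
     \int[mu]_(x in A i) Psg (t - i) (EFin \o V) x < +oo) ->
  exists c : R, exists N0 : nat, (0 < c)%R /\
    forall N, (N0 <= N)%N -> (c * theta0 ^+ N)%:E <= Pinit P mu (alive R X N).
Proof.
move=> [i it epos] Vfin; have {}Vfin := Vfin i it.
have nV := nnmeas_V per H; have ne := nnmeas_eta per H.
have mAi : measurable (A i) := measurable_class per it.
have [mPe Pe0] := nnmeas_Psg mc (t - i) ne.
have [mPV PV0] := nnmeas_Psg mc (t - i) nV.
have mi (h : E -> \bar R) : measurable_fun setT h -> measurable_fun (A i) h.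
  by move=> mh; apply: (@measurable_funS _ _ _ _ setT).
have t0 := period_gt0 per; have th0 := theta0_gt0 H; have th1 := theta0_le1 H.
have C0 := H_C H; have al0 := alpha_gt0 H; have al1 := alpha_lt1 H.
set a := \int[mu]_(x in A i) Psg (t - i) (EFin \o eta) x.
set v := \int[mu]_(x in A i) Psg (t - i) (EFin \o V) x in Vfin.
have apos : 0 < a.
  move: epos; rewrite /eta_ ge0_integralZl_EFin//; last 2 first.
  - exact: mi.
  - exact: (thetaX_ge0 H).
  by rewrite pmule_rgt0// lte_fin (thetaX_gt0 H).
have v0 : 0 <= v by apply: integral_ge0.
have key K N : (N <= t - i + K * t)%N ->
    a <= (theta0 ^- (K * t))%:E * Pinit P mu (alive R X N) + (C * alpha ^+ K)%:E * v.
  move=> NK; have thK := thetaX_ge0 H (K * t).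
  have b0 : (0 <= C * alpha ^+ K)%R by rewrite mulr_ge0// exprn_ge0// ltW.
  have mal n : measurable (alive R X n) := measurable_alive mc n.
  apply: (@le_trans _ _ (\int[mu]_(x in A i)
    ((theta0 ^- (K * t))%:E * P (Some x) (alive R X (t - i + K * t)) +
     (C * alpha ^+ K)%:E * Psg (t - i) (EFin \o V) x))).
    apply: ge0_le_integral => //.
    - exact: mi.
    - apply: mi; apply: emeasurable_funD; apply: measurable_funeM => //.
      exact: measurable_law.
    - by move=> x Ax; exact: survival_ge_eta.
  rewrite ge0_integralD//; first last.
  - by apply: mi; apply: measurable_funeM.
  - by move=> x _; rewrite mule_ge0.
  - by apply: mi; apply: measurable_funeM; exact: measurable_law.
  - by move=> x _; rewrite mule_ge0.
  rewrite ge0_integralZl_EFin//; last by apply: mi; exact: measurable_law.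
  rewrite ge0_integralZl_EFin//; last exact: mi.
  apply: leeD => //; apply: lee_wpmul2l => //.
  apply: (@le_trans _ _ (\int[mu]_(x in A i) P (Some x) (alive R X N))).
    apply: ge0_le_integral => //.
    - by apply: mi; exact: measurable_law.
    - by apply: mi; exact: measurable_law.
    - move=> x _; apply: le_measure; rewrite ?inE//.
      exact: alive_le.
  by apply: ge0_subset_integral => //; exact: measurable_law.
have pfin N : Pinit P mu (alive R X N) \is a fin_num.
  exact: Pinit_fin (measurable_alive mc N).
have vfin : v \is a fin_num by rewrite ge0_fin_numE.
(* Finiteness of mu|A_i (P_(t-i) eta) is read off from the estimate with K = 0. *)
have afin : a \is a fin_num.
  have a0 := ltW apos; rewrite (ge0_fin_numE a0).
  apply: le_lt_trans (key 0%N 0%N _) _ => //.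
  by rewrite -(fineK (pfin 0%N)) -(fineK vfin) -!EFinM -EFinD ltry.
clearbody a v; move: key apos v0.
rewrite -(fineK vfin) -(fineK afin) !(lte_fin, lee_fin).
move: (fine a) (fine v) => {Vfin epos afin vfin}fa fv {}key a0 v0.
have [K0 hK0] := geometric_eventually_le C0 (H_alpha H) v0 (divr_gt0 a0 (ltr0Sn R 1)).
(* With K = N/t + 1, rounded down, one has K >= K0 and N <= K t <= N + t; the overshoot costs
   [theta0 ^+ t]. *)
exists (fa / 2 * theta0 ^+ t)%R, (K0 * t)%N; split.
  by rewrite !mulr_gt0// exprn_gt0.
move=> N NK0.
set K := (N %/ t).+1.
have K0K : (K0 <= K)%N by rewrite leqW// leq_divRL.
have NK : (N <= K * t)%N by exact/ltnW/ltn_ceil.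
have KN : (K * t <= N + t)%N by rewrite /K mulSn addnC leq_add2r leq_divM.
have := key K N (leq_trans NK (leq_addl _ _)).
have h2 := hK0 K K0K.
have thK : (0 < theta0 ^+ (K * t))%R by rewrite exprn_gt0.
rewrite -(fineK (pfin N)); move: (fine (Pinit _ _ _)) => p.
rewrite -!EFinM -EFinD !lee_fin => h1.
have h3 : (fa / 2 <= theta0 ^- (K * t) * p)%R by lra.
have h4 : (fa / 2 * theta0 ^+ (K * t) <= p)%R.
  by rewrite mulrC -ler_pdivlMl.
apply: le_trans h4; rewrite -(mulrA (fa / 2)%R); apply: ler_wpM2l.
  by rewrite divr_ge0// ltW.
by rewrite -exprD addnC; apply: ler_wiXn2l => //; exact: ltW.
Qed.

End survival.

(** * Integration over the initial law and identification of the limit *)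

Section nonnegative_observable.
Context d d' (R : realType) (E : measurableType d) (Om : measurableType d').
Variables (P : R.-pker (option E) ~> Om) (X : nat -> Om -> option E).
Hypothesis mc : absorbed_markov_chain P X.
Variables (t : nat) (A : nat -> set E).
Hypothesis per : periodicity_assumption P X t A.
Variables (V eta : E -> R) (nu : probability E R) (theta0 C alpha : R).
Hypothesis H : assumptionH P X t (A 0%N) V eta nu theta0 C alpha.
Variables (f : E -> R) (M : R).
Hypotheses (mf : measurable_fun setT f) (f0 : forall x, 0 <= f x)
  (fM : forall x, f x <= M) (M0 : 0 <= M).

Local Notation Psg := (Psg P X).
Local Notation upper := (upper A V eta).
Local Notation lower := (lower A V eta).
Local Notation lam := (block_mean P X t eta nu theta0 f).
Variable mu : probability E R.
Local Open Scope ereal_scope.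

Lemma Pinit_deviation (eps : R) : (0 < eps)%R ->
  (forall i, (i < t)%N ->
     \int[mu]_(x in A i) Psg (t - i) (EFin \o V) x < +oo) ->
  exists c : R, exists N0 : nat, forall N, (N0 <= N)%N ->
  Pinit P mu (deviation X f (lam / t%:R) eps N `&` alive R X N) <=
  (c * theta0 ^+ N / N.+1%:R)%:E.
Proof.
move=> eps0 Vfin; have [c [N0 [c0 hc]]] := deviation_bound mc per H mf f0 fM M0 eps0.
have nV := nnmeas_V per H.
have mAi (i : 'I_t) : measurable (A i) := measurable_class per (ltn_ord i).
have mW (i : 'I_t) : measurable_fun setT ((Psg (t - i) (EFin \o V)) \_ (A i)).
  apply/(measurable_restrictT _ (mAi i)).
  by apply: (@measurable_funS _ _ _ _ setT) => //; exact: (nnmeas_Psg mc _ nV).1.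
have W0 (i : 'I_t) x : 0 <= ((Psg (t - i) (EFin \o V)) \_ (A i)) x.
  by apply: erestrict_ge0 => y _; exact: (nnmeas_Psg mc _ nV).2.
(* A single dominating function on all of E, whose integral is the sum of those assumed finite. *)
set W := fun x => \sum_(i < t) ((Psg (t - i) (EFin \o V)) \_ (A i)) x.
have mWs : measurable_fun setT W by apply: emeasurable_sum => i; exact: mW.
have W_ge0 x : 0 <= W x by apply: sume_ge0 => i _; exact: W0.
have IW : \int[mu]_x W x = \sum_(i < t) \int[mu]_(x in A i) Psg (t - i) (EFin \o V) x.
  rewrite ge0_integral_sum//.
  by apply: eq_bigr => i _; rewrite -integral_mkcond.
have Wfin : \int[mu]_x W x < +oo.
  by rewrite IW; apply: lte_sum_pinfty => i _; exact: Vfin.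
exists (c * fine (\int[mu]_x W x))%R, N0 => N NN.
have k0 : (0 <= c * theta0 ^+ N / N.+1%:R)%R.
  by rewrite divr_ge0 ?mulr_ge0 ?exprn_ge0// ltW// (theta0_gt0 H).
have mB : measurable (deviation X f (lam / t%:R) eps N `&` alive R X N).
  apply: measurableI; last exact: (measurable_alive mc).
  exact: (measurable_deviation mc mf).
apply: (@le_trans _ _ (\int[mu]_x ((c * theta0 ^+ N / N.+1%:R)%:E * W x))).
  apply: ge0_le_integral => //.
  - exact: measurable_law.
  - exact: measurable_funeM.
  - move=> x _; have [i it Ax] := class_cover per x.
    apply: le_trans (hc N i x NN it Ax) _; apply: lee_wpmul2l => //.
    rewrite /W (bigD1 (Ordinal it))//= patchE mem_set//.
    by rewrite leeDl// sume_ge0.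
rewrite ge0_integralZl_EFin// -(@fineK _ (\int[mu]_x W x)); last first.
  by rewrite ge0_fin_numE// integral_ge0.
by rewrite -EFinM lee_fin le_eqVlt; apply/orP; left; apply/eqP; ring.
Qed.

Definition ergodic_term (u : E -> \bar R) l x : \bar R :=
  Psg l (fmul f (Psg (t - l) u)) x.

(** By [M1_sum] over one period the sum is nu of the unnormalised first moment of eta, so that the
    announced limit equals lam / t. *)
Lemma ergodic_sum :
  \sum_(l < t) \int[nu]_x ergodic_term (EFin \o eta) l x = (theta0 ^+ t * lam)%:E.
Proof.
have ne := nnmeas_eta per H.
have nt (l : 'I_t) : nnmeas (ergodic_term (EFin \o eta) l).
  apply: (nnmeas_Psg mc); apply: (nnmeas_fmul mf f0).
  exact: (nnmeas_Psg mc).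
rewrite -ge0_integral_sum//; last 2 first.
- by move=> l; case: (nt l).
- by move=> l x _; case: (nt l).
rewrite EFinM -(lamE mc per H mf f0 fM M0).
have [mD D0] := nnmeas_Dn mc H mf f0 1 ne.
rewrite -ge0_integralZl_EFin//; last first.
  by rewrite exprn_ge0// ltW// (theta0_gt0 H).
apply: eq_integral => x _; rewrite /block_moment1 mul1n muleA -EFinM mulfV.
  by rewrite mul1e (M1_sum mc mf f0).
by rewrite expf_neq0// gt_eqF// (theta0_gt0 H).
Qed.

Lemma ergodic_term_fin (l : 'I_t) :
  \int[nu]_x ergodic_term (EFin \o eta) l x \is a fin_num.
Proof.
have I0 (k : 'I_t) : 0 <= \int[nu]_x ergodic_term (EFin \o eta) k x.
  apply: integral_ge0 => x _; apply: (nnmeas_Psg mc _ _).2.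
  by apply: (nnmeas_fmul mf f0); apply: (nnmeas_Psg mc); exact: (nnmeas_eta per H).
rewrite ge0_fin_numE//; apply: le_lt_trans (ltry (theta0 ^+ t * lam)%R).
rewrite -ergodic_sum (bigD1 l)//=; apply: leeDl; exact: sume_ge0.
Qed.

End nonnegative_observable.

(** * Signed observables *)

Section signed_observable.
Context d d' (R : realType) (E : measurableType d) (Om : measurableType d').
Variables (P : R.-pker (option E) ~> Om) (X : nat -> Om -> option E).
Hypothesis mc : absorbed_markov_chain P X.
Variables (t : nat) (A : nat -> set E).
Hypothesis per : periodicity_assumption P X t A.
Variables (V eta : E -> R) (nu : probability E R) (theta0 C alpha : R).
Hypothesis H : assumptionH P X t (A 0%N) V eta nu theta0 C alpha.
Variables (f : E -> R) (M : R).
Hypotheses (mf : measurable_fun setT f) (fM : forall x, `|f x| <= M).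

Local Notation Psg := (Psg P X).
Local Notation lam g := (block_mean P X t eta nu theta0 g).

Definition pos_part (x : E) : R := Num.max (f x) 0.
Definition neg_part (x : E) : R := Num.max (- f x) 0.

Lemma pos_part_ge0 x : 0 <= pos_part x.
Proof. by rewrite /pos_part le_max lexx orbT. Qed.

Lemma neg_part_ge0 x : 0 <= neg_part x.
Proof. by rewrite /neg_part le_max lexx orbT. Qed.

(** The argument is a witness that E is inhabited; otherwise [M] could be negative. *)
Lemma part_bound_ge0 : E -> 0 <= M.
Proof. by move=> x; exact: le_trans (fM x). Qed.

Lemma pos_part_le x : pos_part x <= M.
Proof.
by rewrite /pos_part ge_max (le_trans (ler_norm _) (fM x)) (part_bound_ge0 x).
Qed.

Lemma neg_part_le x : neg_part x <= M.
Proof.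
rewrite /neg_part ge_max (part_bound_ge0 x) andbT.
by apply: le_trans (fM x); rewrite -normrN ler_norm.
Qed.

Lemma measurable_pos_part : measurable_fun setT pos_part.
Proof. exact: measurable_maxr. Qed.

Lemma measurable_neg_part : measurable_fun setT neg_part.
Proof. by apply: measurable_maxr => //; exact: measurable_funN. Qed.

Lemma partsB x : pos_part x - neg_part x = f x.
Proof.
rewrite /pos_part /neg_part; have [f0|/ltW f0] := leP 0 (f x).
  by rewrite max_r ?oppr_le0// subr0.
by rewrite max_l ?oppr_ge0// sub0r opprK.
Qed.

Local Open Scope ereal_scope.

(** The integral is by definition that of the positive part minus that of the negative part, and for
    [u] nonnegative these are the parts of [f] times [u]. The identity thus holds for infinite
    values too. *)
Lemma Psg_signed l (u : E -> \bar R) x : (forall y, 0 <= u y) ->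
  Psg l (fun y => (f y)%:E * u y) x =
  Psg l (fmul pos_part u) x - Psg l (fmul neg_part u) x.
Proof.
move=> u0; rewrite /Defs.Psg integralE; congr (_ - _);
  apply: eq_integral => w _; rewrite ?funeposE ?funenegE;
  (case: (X l w) => [y|]/=; last by rewrite max_l ?oppr0); rewrite /fmul.
- rewrite /pos_part; have [f0|/ltW f0] := leP 0%R (f y).
    by rewrite max_l//; apply: mule_ge0; rewrite ?lee_fin.
  by rewrite mul0e max_r//; apply: mule_le0_ge0; rewrite ?lee_fin.
- rewrite /neg_part -mulNe -EFinN; have [f0|/ltW f0] := leP 0%R (- f y)%R.
    by rewrite max_l//; apply: mule_ge0; rewrite ?lee_fin.
  by rewrite mul0e max_r//; apply: mule_le0_ge0; rewrite ?lee_fin.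
Qed.

Lemma ergodic_limit_signed : E ->
  ergodic_limit P X t theta0 eta nu f =
  ((lam pos_part / t%:R) - (lam neg_part / t%:R))%:E.
Proof.
move=> x0; have M0 := part_bound_ge0 x0.
have ne := nnmeas_eta per H.
have nm (g : E -> R) : measurable_fun setT g -> (forall x, (0 <= g x)%R) -> forall l,
    nnmeas (ergodic_term P X t g (EFin \o eta) l).
  move=> mg g0 l; apply: (nnmeas_Psg mc); apply: (nnmeas_fmul mg g0).
  exact: (nnmeas_Psg mc).
have np := nm _ measurable_pos_part pos_part_ge0.
have nn := nm _ measurable_neg_part neg_part_ge0.
have pfin := ergodic_term_fin mc per H measurable_pos_part pos_part_ge0 pos_part_le M0.
have nfin := ergodic_term_fin mc per H measurable_neg_part neg_part_ge0 neg_part_le M0.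
have psum := ergodic_sum mc per H measurable_pos_part pos_part_ge0 pos_part_le M0.
have nsum := ergodic_sum mc per H measurable_neg_part neg_part_ge0 neg_part_le M0.
have int (g : E -> \bar R) : nnmeas g -> \int[nu]_x g x \is a fin_num ->
    nu.-integrable setT g.
  move=> [mg g0] fin; apply/integrableP; split => //.
  under eq_integral do rewrite gee0_abs//.
  by rewrite -ge0_fin_numE// integral_ge0.
have real_terms (g : E -> R) : (forall l : 'I_t,
      \int[nu]_x ergodic_term P X t g (EFin \o eta) l x \is a fin_num) ->
    exists r : 'I_t -> R, forall l : 'I_t,
      \int[nu]_x ergodic_term P X t g (EFin \o eta) l x = (r l)%:E.
  move=> gfin; exists (fun l : 'I_t =>
    fine (\int[nu]_x ergodic_term P X t g (EFin \o eta) l x)).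
  by move=> l; rewrite (fineK (gfin l)).
have [p pE] := real_terms _ pfin; have [n nE] := real_terms _ nfin.
have term (l : 'I_t) : \int[nu]_x Psg l
    (fun y => (f y)%:E * Psg (t - l) (EFin \o eta) y) x = (p l - n l)%:E.
  transitivity (\int[nu]_x (ergodic_term P X t pos_part (EFin \o eta) l x -
                            ergodic_term P X t neg_part (EFin \o eta) l x)).
    apply: eq_integral => x _; apply: Psg_signed => y.
    exact: (nnmeas_Psg mc _ ne).2.
  (* Both parts are nu-integrable by [ergodic_term_fin], which excludes an indeterminate
     difference. *)
  by rewrite (integralB measurableT (int _ (np l) (pfin l))
    (int _ (nn l) (nfin l))) pE nE.
have sumP (g : E -> R) (r : 'I_t -> R) (z : R) :
    \sum_(l < t) \int[nu]_x ergodic_term P X t g (EFin \o eta) l x = z%:E ->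
    (forall l : 'I_t, \int[nu]_x ergodic_term P X t g (EFin \o eta) l x = (r l)%:E) ->
    (\sum_(l < t) r l = z)%R.
  move=> gs gr; apply: EFin_inj; rewrite -gs -sumEFin.
  by apply: eq_bigr => l _; rewrite gr.
rewrite /ergodic_limit (eq_bigr _ (fun l _ => term l)) sumEFin sumrB -EFinM.
rewrite (sumP _ _ _ psum pE) (sumP _ _ _ nsum nE); congr (_%:E).
have tR : (t%:R != 0 :> R)%R by rewrite pnatr_eq0 -lt0n (period_gt0 per).
have th0 : (theta0 ^+ t != 0)%R by rewrite expf_neq0// gt_eqF// (theta0_gt0 H).
move: (t%:R : R)%R (theta0 ^+ t)%R tR th0 => u z u0 z0.
move: (lam pos_part) (lam neg_part) => lp ln.
by field; rewrite u0.
Qed.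

Lemma deviation_signed (lp ln eps : R) N :
  deviation X f (lp - ln) eps N `<=`
  deviation X pos_part lp (eps / 2) N `|` deviation X neg_part ln (eps / 2) N.
Proof.
move=> w; rewrite /deviation /=.
have -> : (time_average X f N w =
    time_average X pos_part N w - time_average X neg_part N w)%R.
  rewrite /time_average -mulrBr -sumrB; congr (_ * _)%R.
  by apply: eq_bigr => m _; case: (X m w) => [y|]/=; rewrite ?partsB ?subrr.
move: (time_average X pos_part N w) (time_average X neg_part N w) => a b h.
have h1 := ler_normB (a - lp)%R (b - ln)%R.
have e : (a - lp - (b - ln) = a - b - (lp - ln))%R by ring.
rewrite e in h1; case: (ltP (eps / 2) `|a - lp|)%R => h2; first by left.
by right; lra.
Qed.

End signed_observable.

(** * Passage to the conditional probability *)

Section initial_law.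
Context d d' (R : realType) (E : measurableType d) (Om : measurableType d').
Variables (P : R.-pker (option E) ~> Om) (mu : probability E R).
Local Open Scope ereal_scope.

Lemma Pinit_subadditive (B B1 B2 : set Om) : measurable B -> measurable B1 ->
  measurable B2 -> B `<=` B1 `|` B2 ->
  Pinit P mu B <= Pinit P mu B1 + Pinit P mu B2.
Proof.
move=> mB mB1 mB2 B12; have mP (D : set Om) : measurable D ->
    measurable_fun setT (fun x => P (Some x) D) by exact: measurable_law.
rewrite /Pinit -(ge0_integralD mu measurableT _ (mP _ mB1) _ (mP _ mB2))//.
apply: ge0_le_integral => //; first exact: mP.
  by apply: emeasurable_funD; exact: mP.
move=> x _; apply: (@le_trans _ _ (P (Some x) (B1 `|` B2))).
  by apply: le_measure; rewrite ?inE//; exact: measurableU.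
exact: measureU2.
Qed.

End initial_law.

Section conditional_deviation.
Context d d' (R : realType) (E : measurableType d) (Om : measurableType d').
Variables (P : R.-pker (option E) ~> Om) (X : nat -> Om -> option E).
Hypothesis mc : absorbed_markov_chain P X.
Variables (mu : probability E R) (f : E -> R) (theta0 : R).
Hypotheses (mf : measurable_fun setT f) (theta0_gt0 : 0 < theta0).

(** The factor [theta0 ^+ N] cancels in the quotient, leaving a multiple of 1/(N+1). *)
Lemma Pcond_deviation_cvg (lp ln eps c c1 c2 : R) (N0 N1 N2 : nat) : 0 < c ->
  (forall N, (N0 <= N)%N ->
    ((c * theta0 ^+ N)%:E <= Pinit P mu (alive R X N))%E) ->
  (forall N, (N1 <= N)%N ->
    (Pinit P mu (deviation X (pos_part f) lp (eps / 2) N `&` alive R X N) <=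
     (c1 * theta0 ^+ N / N.+1%:R)%:E)%E) ->
  (forall N, (N2 <= N)%N ->
    (Pinit P mu (deviation X (neg_part f) ln (eps / 2) N `&` alive R X N) <=
     (c2 * theta0 ^+ N / N.+1%:R)%:E)%E) ->
  Pcond P mu (deviation X f (lp - ln) eps N) (alive R X N) @[N --> \oo] --> (0 : R).
Proof.
move=> c0 h0 h1 h2.
have mp := measurable_pos_part mf; have mn := measurable_neg_part mf.
rewrite -[X in _ --> X](mulr0 ((c1 + c2) / c)).
apply: (@squeeze_cvgr _ _ _ _ (cst 0) (fun N => (c1 + c2) / c * harmonic N));
  last 2 first.
- by rewrite mulr0; exact: cvg_cst.
- by apply: cvgM; [exact: cvg_cst|exact: cvg_harmonic].
exists (N0 + N1 + N2)%N => // N /= NN.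
have N0N : (N0 <= N)%N by apply: leq_trans NN; rewrite -addnA leq_addr.
have N1N : (N1 <= N)%N by apply: leq_trans NN; rewrite addnAC leq_addl.
have N2N : (N2 <= N)%N by apply: leq_trans NN; rewrite leq_addl.
have mal : measurable (alive R X N) := measurable_alive mc N.
have mB (g : E -> R) l e : measurable_fun setT g ->
    measurable (deviation X g l e N `&` alive R X N).
  by move=> mg; apply: measurableI => //; exact: (measurable_deviation mc mg).
rewrite /Pcond.
have := h0 N N0N; have := h1 N N1N; have := h2 N N2N.
have : (Pinit P mu (deviation X f (lp - ln) eps N `&` alive R X N) <=
    Pinit P mu (deviation X (pos_part f) lp (eps / 2) N `&` alive R X N) +
    Pinit P mu (deviation X (neg_part f) ln (eps / 2) N `&` alive R X N))%E.
  apply: Pinit_subadditive; try exact: mB.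
  by rewrite -setIUl; apply: setSI; exact: deviation_signed.
rewrite -(fineK (Pinit_fin P mu mal)) -(fineK (Pinit_fin P mu (mB f (lp - ln) eps mf))).
rewrite -(fineK (Pinit_fin P mu (mB _ lp (eps / 2) mp))).
rewrite -(fineK (Pinit_fin P mu (mB _ ln (eps / 2) mn))).
have p0 := fine_ge0 (Pinit_ge0 P mu (deviation X f (lp - ln) eps N `&` alive R X N)).
move: (fine (Pinit P mu (alive R X N))) p0.
move: (fine _) (fine _) (fine _) => r q p s p0.
rewrite -EFinD !lee_fin => pqr hr hq hs.
have th0 : 0 < theta0 ^+ N by rewrite exprn_gt0.
have s0 : 0 < s by apply: lt_le_trans hs; rewrite mulr_gt0.
have N0' : 0 < N.+1%:R :> R by rewrite ltr0n.
rewrite /harmonic /=; apply/andP; split; first by rewrite divr_ge0// ltW.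
rewrite ler_pdivrMr//.
have hp : p <= (c1 + c2) * theta0 ^+ N / N.+1%:R.
  apply: (le_trans pqr); apply: le_trans (lerD hq hr) _.
  by rewrite -mulrDl -mulrDl.
have k0 : 0 <= (c1 + c2) * theta0 ^+ N / N.+1%:R by exact: le_trans hp.
(* The sign comes from the fact that the bound dominates a probability. *)
have c12 : 0 <= c1 + c2.
  by move: k0; rewrite -mulrA pmulr_lge0// mulr_gt0// invr_gt0.
apply: (le_trans hp).
apply: (@le_trans _ _ ((c1 + c2) / c / N.+1%:R * (c * theta0 ^+ N))).
  rewrite le_eqVlt; apply/orP; left; apply/eqP.
  by field; rewrite gt_eqF//= gt_eqF.
by apply: ler_wpM2l => //; rewrite divr_ge0 ?divr_ge0// ltW.
Qed.

End conditional_deviation.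

Theorem corollary6p2 (d d' : measure_display) (R : realType)
    (E : measurableType d) (Om : measurableType d')
    (P : R.-pker (option E) ~> Om) (X : nat -> Om -> option E)
    (t : nat) (A : nat -> set E) (V eta : E -> R) (nu : probability E R)
    (theta0 C alpha : R) :
  absorbed_markov_chain P X ->
  periodicity_assumption P X t A ->
  assumptionH P X t (A 0%N) V eta nu theta0 C alpha ->
  forall (f : E -> R) (mu : probability E R),
    measurable_fun setT f ->
    [bounded f x | x in setT] ->
    (exists2 i, (i < t)%N &
       (0 < \int[mu]_(x in A i) eta_ P X theta0 eta (t - i) x)%E) ->
    (forall i, (i < t)%N ->
       (\int[mu]_(x in A i) Psg P X (t - i) (EFin \o V) x < +oo)%E) ->
    forall eps : R, 0 < eps ->
      Pcond P mu
        [set w | (eps%:E < `| (time_average X f N w)%:E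
                             - ergodic_limit P X t theta0 eta nu f |)%E]
        (alive R X N) @[N --> \oo] --> (0 : R).
Proof.
move=> mc per H f mu mf [b [_ fb]] eta_pos V_fin eps eps0.
(* A point of E, obtained from eta being nonzero, gives the bound of [f] its sign. *)
have [x0 _ _] := H_eta_neq0 H.
have fM x : `|f x| <= b + 1 by apply: fb => //; rewrite ltrDl.
have b0 := part_bound_ge0 fM x0.
have mp := measurable_pos_part mf; have mn := measurable_neg_part mf.
have eps2 : 0 < eps / 2 by rewrite divr_gt0.
have [c1 [N1 h1]] := Pinit_deviation mc per H mp (pos_part_ge0 f)
  (pos_part_le fM) b0 eps2 V_fin.
have [c2 [N2 h2]] := Pinit_deviation mc per H mn (neg_part_ge0 f)
  (neg_part_le fM) b0 eps2 V_fin.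
have [c [N0 [c0 h0]]] := survival_lower mc per H eta_pos V_fin.
rewrite (ergodic_limit_signed mc per H mf fM x0).
(* With the limit rewritten as a real number, the event over extended reals is [deviation] by
   conversion. *)
exact: (Pcond_deviation_cvg mc mf (theta0_gt0 H) c0 h0 h1 h2).
Qed.
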